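(* For every $\varepsilon\in(0,1/2)$ there exist constants $C,\mu>0$, depending only on $\varepsilon$, such that the following holds for every function $p=p(n)$ with $C\log n/n\le p\le1$. Let $G\sim\mathbb G(n,p)$. Asymptotically almost surely (with probability tending to $1$ as $n\to\infty$), both of the following hold simultaneously: (i) for every relative $\varepsilon$-Dirac subgraph $H$ of $G$, every globally $\mu pn$-bounded colouring of the edges of $H$ admits a rainbow Hamilton cycle in $H$; (ii) for every absolute $\varepsilon$-Dirac subgraph $H$ of $G$ at density $p$, every globally $\mu pn$-bounded colouring of the edges of $H$ admits a rainbow Hamilton cycle in $H$.
   Context: $\mathbb G(n,p)$ is the binomial random graph on $n$ vertices in which each pair is an edge independently with probability $p$. $\delta(\cdot)$ denotes minimum degree. A spanning subgraph $H$ of an $n$-vertex graph $G$ is an absolute $\varepsilon$-Dirac subgraph of $G$ at density $p$ if $\delta(H)\ge(\tfrac12+\varepsilon)pn$. It is a relative $\varepsilon$-Dirac subgraph of $G$ if $\deg_H(v)\ge(\tfrac12+\varepsilon)\deg_G(v)$ for every $v\in V(G)$. An edge-colouring of a graph is globally $k$-bounded if each colour appears on at most $k$ edges of the graph. A subgraph is rainbow if all its edges have distinct colours. *)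

(* Defs.v *)
From HB Require Import structures.
From mathcomp Require Import all_boot all_order all_algebra.
From mathcomp Require Import all_classical all_reals all_analysis.

Set Implicit Arguments.
Unset Strict Implicit.
Unset Printing Implicit Defensive.

Import Order.TTheory GRing.Theory Num.Theory.
Import numFieldNormedType.Exports.

Local Open Scope ring_scope.

(* A graph on the vertex set 'I_n is represented by its edge set, a subset of
   [pairs n]; all subgraphs considered are spanning, so [H] is a subgraph of
   [G] iff [H \subset G]. *)
Definition pairs (n : nat) : {set {set 'I_n}} :=
  [set e : {set 'I_n} | #|e| == 2%N].

Definition deg (n : nat) (G : {set {set 'I_n}}) (v : 'I_n) : nat :=
  #|[set e in G | v \in e]|.

(* The neutral value [n] exceeds every degree, so it only matters for the
   graph without vertices. *)
Definition mindeg (n : nat) (G : {set {set 'I_n}}) : nat :=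
  \big[minn/n]_(v < n) deg G v.

(* Probability that the binomial random graph G(n, p) satisfies [A]: a graph
   [G] has mass p ^ e(G) * (1 - p) ^ (binomial(n, 2) - e(G)). *)
Definition gnp_prob (R : realType) (n : nat) (p : R)
    (A : {set {set 'I_n}} -> Prop) : R :=
  \sum_(G : {set {set 'I_n}} | (G \subset pairs n) && `[< A G >])
    p ^+ #|G| * (1 - p) ^+ #|pairs n :\: G|.

Definition absolute_Dirac (R : realType) (n : nat) (eps p : R)
    (G H : {set {set 'I_n}}) : Prop :=
  H \subset G /\ (2^-1 + eps) * p * n%:R <= (mindeg H)%:R.

Definition relative_Dirac (R : realType) (n : nat) (eps : R)
    (G H : {set {set 'I_n}}) : Prop :=
  H \subset G /\ forall v : 'I_n, (2^-1 + eps) * (deg G v)%:R <= (deg H v)%:R.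

(* A colouring of the edges of [H] is given by a function on all vertex sets;
   only its values on [H] are ever used. *)
Definition globally_bounded (R : realType) (n : nat) (K : eqType) (k : R)
    (H : {set {set 'I_n}}) (c : {set 'I_n} -> K) : Prop :=
  forall a : K, #|[set e in H | c e == a]|%:R <= k.

Definition rainbow (n : nat) (K : eqType) (F : {set {set 'I_n}})
    (c : {set 'I_n} -> K) : Prop :=
  {in F &, injective c}.

Definition cycle_edges (n : nat) (s : seq 'I_n) : {set {set 'I_n}} :=
  [set [set x; next s x] | x in s].

(* [F] is the edge set of a Hamilton cycle of [H]: [s] lists all the vertices,
   each exactly once, in cyclic order. *)
Definition hamilton_cycle (n : nat) (H F : {set {set 'I_n}}) : Prop :=
  (3 <= n)%N /\
  exists s : seq 'I_n,
    [/\ uniq s, forall x : 'I_n, x \in s, F = cycle_edges s & F \subset H].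

Definition rainbow_hamiltonian (R : realType) (n : nat) (k : R)
    (H : {set {set 'I_n}}) : Prop :=
  forall (K : eqType) (c : {set 'I_n} -> K), globally_bounded k H c ->
    exists2 F : {set {set 'I_n}}, hamilton_cycle H F & rainbow F c.

(* Main.v *)
(* The rainbow Hamilton cycle is grown from a sparse rainbow expander by
   rotations and boosters, both of which respect the colouring because only
   O(n) edges, hence only O(mu p n^2) edges of conflicting colours, are ever
   involved.

   Expander.  Let every vertex of H choose six incident edges, all choices
   having distinct colours, uniformly at random among all such choices.
   Rosenfeld's counting argument shows that prescribed choices at t slots have
   probability at most (4 / (p n)) ^ t.  A first moment computation over G(n, p),
   in which the powers of p cancel, then excludes that the 6 |S| edges chosen
   at a small set S stay inside a set of 3 |S| vertices.

   Booster.  Let R be a rainbow expander with O(n) edges and V its longest path.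
   By Posa's lemma, linearly many x are linked to linearly many y by a path
   P(x, y) on V in R.  If xw and yv are edges of H, where v precedes w on
   P(x, y), then exchanging vw for xw and yv closes P(x, y) to a cycle.  For
   given y let A(y) be the set of the v for which many edges xw of H fit; counting
   the degrees of the x in H, the average of |A(y)| is more than n/2, and a
   set R1 of O(n) edges xw already suffices for almost all of A(y).  Were no
   edge yv of H usable, all edges of H at y would avoid the set hit by R1, so
   that y would have degree less than (1/2 + eps) p n on average.  The numbers
   of edges of G involved are concentrated with error probability
   exp(- c p n^2), whereas R and R1, which determine all the sets concerned,
   are subsets of G of size O(n), so a union bound applies. *)
Require Import Defs.
From HB Require Import structures.
From mathcomp Require Import all_boot all_order all_algebra.
From mathcomp Require Import all_classical all_reals all_analysis.
(* Imported again so that [set0], [subsetP], etc. refer to finite sets. *)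
From mathcomp Require Import fintype finset.
From mathcomp Require Import ring lra zify.

Set Implicit Arguments.
Unset Strict Implicit.
Unset Printing Implicit Defensive.

Import Order.TTheory GRing.Theory Num.Theory.
Import numFieldNormedType.Exports.

Local Open Scope ring_scope.

(** * Rainbow transversals *)

Lemma leq_card_bigcup (I T : finType) (P : pred I) (F : I -> {set T}) :
  (#|\bigcup_(i | P i) F i| <= \sum_(i | P i) #|F i|)%N.
Proof.
elim/big_rec2: _ => [|i k A _ IH]; first by rewrite cards0.
by apply: leq_trans (leq_card_setU _ _) _; rewrite leq_add2l.
Qed.

Section Transversals.
Variables (R : realFieldType) (I E : finType) (K : eqType).
Variables (adm : I -> {set E}) (col : I -> E -> K) (e0 : E).

(** The dummy value [e0] outside [J] makes partial transversals total functions of one type, so that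
    each is counted once and those for different [J] can be compared. *)
Definition transversal (J : {set I}) (f : {ffun I -> E}) : bool :=
  [&& [forall i in J, f i \in adm i], [forall i in ~: J, f i == e0] &
      [forall i in J, forall j in J, (i != j) ==> (col i (f i) != col j (f j))]].

Definition transversals (J : {set I}) := [set f | transversal J f].

Lemma transversalP (J : {set I}) (f : {ffun I -> E}) :
  reflect [/\ {in J, forall i, f i \in adm i}, forall i, i \notin J -> f i = e0 &
      {in J &, forall i j, i != j -> col i (f i) != col j (f j)}]
    (f \in transversals J).
Proof.
rewrite inE; apply: (iffP and3P) => -[h1 h2 h3]; split.
- by move=> i iJ; apply: (forall_inP h1).
- by move=> i iJ; apply/eqP/(forall_inP h2); rewrite inE.
- by move=> i j iJ jJ ij; move/forall_inP: h3 => /(_ i iJ)/forall_inP/(_ j jJ)/implyP/(_ ij).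
- by apply/forall_inP => i iJ; apply: h1.
- by apply/forall_inP => i iJ; rewrite h2 // -in_setC.
- apply/forall_inP => i iJ; apply/forall_inP => j jJ; apply/implyP => ij; exact: h3.
Qed.

(** Once the values on [S] are prescribed, resetting them to [e0] loses no information. *)
Lemma card_transversals_prescribed (J S : {set I}) (g : I -> E) : S \subset J ->
  (#|[set f in transversals J | [forall i in S, f i == g i]]|
     <= #|transversals (J :\: S)|)%N.
Proof.
move=> SJ; pose r (f : {ffun I -> E}) := [ffun i => if i \in S then e0 else f i].
rewrite -(@card_in_imset _ _ r); last first.
  move=> f f'; rewrite !inE => /andP[_ /forall_inP hf] /andP[_ /forall_inP hf'] /ffunP rr.
  apply/ffunP => i; move: (rr i); rewrite !ffunE; case: ifP => // iS _.
  by rewrite (eqP (hf i iS)) (eqP (hf' i iS)).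
apply/subset_leq_card/subsetP => _ /imsetP[f + ->].
rewrite inE => /andP[/transversalP[h1 h2 h3] _]; apply/transversalP; split.
- by move=> i; rewrite inE ffunE => /andP[/negbTE -> iJ]; apply: h1.
- by move=> i; rewrite inE ffunE; case: ifP => //= _; apply: h2.
- move=> i j; rewrite !inE !ffunE => /andP[/negbTE -> iJ] /andP[/negbTE -> jJ]; exact: h3.
Qed.

Variables (m D : R).
Hypothesis m_gt0 : 0 < m.
Hypothesis adm_ge : forall i, m <= #|adm i|%:R.
Hypothesis col_le : forall a, (\sum_i #|[set e in adm i | col i e == a]|)%:R <= D.
Hypothesis D_le : 4 * D <= m.

(** A pair of a transversal [f] of [J] and a choice [e] at [b] either extends [f] or conflicts in
    colour with some [f j]. In the second case the value at [j] is one of the [e'] of the colour of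
    [e], and prescribing it leaves at most the transversals of [J :\ j]. *)
Lemma card_transversals_extend_sub (J : {set I}) b : b \notin J ->
  (#|transversals J| * #|adm b| <= #|transversals (b |: J)| +
     \sum_(e in adm b) \sum_(j in J) \sum_(e' in adm j | col j e' == col b e)
        #|transversals (J :\ j)|)%N.
Proof.
move=> bJ.
pose good := [set fe : {ffun I -> E} * E | [&& fe.1 \in transversals J, fe.2 \in adm b &
   [forall j in J, col j (fe.1 j) != col b fe.2]]].
pose bad := [set fe : {ffun I -> E} * E | [&& fe.1 \in transversals J, fe.2 \in adm b &
   [exists j in J, col j (fe.1 j) == col b fe.2]]].
have -> : (#|transversals J| * #|adm b| = #|good| + #|bad|)%N.
  rewrite -cardsX -(cardsID good); congr (_ + _)%N; apply: eq_card => -[f e].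
    by rewrite !inE /=; case: (transversal J f) => //=; case: (e \in adm b).
  rewrite !inE /=; case: (transversal J f) => //=; case: (e \in adm b) => //=; rewrite ?andbT ?andbF //.
  by rewrite negb_forall_in; apply: eq_existsb => j; rewrite negbK.
apply: leq_add.
  pose h (fe : {ffun I -> E} * E) := [ffun i => if i == b then fe.2 else fe.1 i].
  rewrite -(@card_in_imset _ _ h); last first.
    move=> [f e] [f' e']; rewrite !inE /= => /and3P[tf _ _] /and3P[tf' _ _] /ffunP hh.
    have := hh b; rewrite !ffunE eqxx /= => ->; congr (_, _); apply/ffunP => i.
    have := hh i; rewrite !ffunE /=; case: eqP => // -> _.
    have /transversalP[_ h2 _] : f \in transversals J by rewrite inE.
    have /transversalP[_ h2' _] : f' \in transversals J by rewrite inE.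
    by rewrite h2 ?h2'.
  apply/subset_leq_card/subsetP => _ /imsetP[[f e] + ->].
  rewrite inE /= => /and3P[/transversalP[h1 h2 h3] eb /forall_inP hc].
  apply/transversalP; split.
  - move=> i; rewrite !inE ffunE /=; case: eqP => [-> //|_ /= iJ]; exact: h1.
  - by move=> i; rewrite !inE ffunE /=; case: eqP => //= _; apply: h2.
  - move=> i j; rewrite !inE !ffunE /=; do 2![case: eqP] => [-> ->|ib -> _ jJ|-> jb iJ _|ib jb] //=.
    + by rewrite eqxx.
    + by move=> _; rewrite eq_sym hc.
    + by move=> _; apply: hc.
    + exact: h3.
have bs : bad \subset \bigcup_(e in adm b) \bigcup_(j in J)
     \bigcup_(e' in [set e' in adm j | col j e' == col b e])
       [set (f, e) | f in [set f in transversals J | [forall i in [set j], f i == e']]].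
  apply/subsetP => -[f e]; rewrite inE /= => /and3P[ft eb /exists_inP[j jJ cj]].
  apply/bigcupP; exists e => //; apply/bigcupP; exists j => //.
  have /transversalP[h1 _ _] := ft.
  apply/bigcupP; exists (f j); first by rewrite inE h1.
  apply/imsetP; exists f => //; rewrite inE ft /=.
  by apply/forall_inP => i; rewrite inE => /eqP ->.
apply: leq_trans (subset_leq_card bs) _.
apply: leq_trans (leq_card_bigcup _ _ ) _; apply: leq_sum => e eb.
apply: leq_trans (leq_card_bigcup _ _ ) _; apply: leq_sum => j jJ.
apply: leq_trans (leq_card_bigcup _ _ ) _.
rewrite [X in (X <= _)%N](eq_bigl (fun e' => (e' \in adm j) && (col j e' == col b e))); last by move=> e'; rewrite inE.
apply: leq_sum => e' _.
apply: leq_trans (leq_imset_card _ _) _.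
by rewrite card_transversals_prescribed // sub1set.
Qed.

(* Rosenfeld's counting argument: the induction hypothesis bounds the number of
   transversals lost to a colour conflict at [b]. *)
Lemma card_transversals_extend (J : {set I}) b : b \notin J ->
  m / 2 * #|transversals J|%:R <= #|transversals (b |: J)|%:R.
Proof.
have [k] := ubnP #|J|; elim: k J b => // k IH J b; rewrite ltnS => Jk bJ.
set F := #|transversals J|%:R.
have F0 : 0 <= F :> R by exact: ler0n.
have FJ j : j \in J -> #|transversals (J :\ j)|%:R <= 2 / m * F.
  move=> jJ; have := IH (J :\ j) j; rewrite setD1K // setD11 => /(_ _ isT) H.
  rewrite -ler_pdivrMl ?divr_gt0 // invf_div; apply: H.
  by rewrite (cardsD1 j J) jJ add1n in Jk.
have := card_transversals_extend_sub bJ; rewrite -(ler_nat R) natrM natrD -/F => H.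
suff S_le : (\sum_(e in adm b) \sum_(j in J) \sum_(e' in adm j | col j e' == col b e)
        #|transversals (J :\ j)|)%:R <= #|adm b|%:R * (F / 2).
  have : m * F <= #|adm b|%:R * F by rewrite ler_wpM2r.
  move: H S_le; set X := #|_|%:R; set S := _%:R; nra.
rewrite natr_sum mulr_natl -[leRHS]sumr_const; apply: ler_sum => e eb.
apply: (@le_trans _ _ (\sum_(j in J) #|[set e' in adm j | col j e' == col b e]|%:R * (2 / m * F))).
  rewrite natr_sum; apply: ler_sum => j jJ.
  rewrite natr_sum mulr_natl -[leRHS]sumr_const.
  rewrite [leRHS](eq_bigl (fun e' => (e' \in adm j) && (col j e' == col b e))); last by move=> e'; rewrite inE.
  by apply: ler_sum => e' _; rewrite FJ.
rewrite -mulr_suml.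
have := col_le (col b e); rewrite natr_sum => cl.
have Dle : \sum_(j in J) #|[set e' in adm j | col j e' == col b e]|%:R <= D :> R.
  apply: le_trans cl; rewrite [leRHS](bigID (mem J)) /= lerDl; exact: sumr_ge0.
apply: (@le_trans _ _ (D * (2 / m * F))).
  by rewrite ler_wpM2r // mulr_ge0 // divr_ge0 // ltW.
(* As [4 * D <= m], conflicts destroy at most half of the choices at [b]. *)
have -> : D * (2 / m * F) = (4 * D / m) * (F / 2) by field; rewrite gt_eqF.
by rewrite -[leRHS]mul1r ler_wpM2r ?divr_ge0 // ler_pdivrMr // mul1r.
Qed.

Lemma card_transversals_extend_set (J S : {set I}) : S \subset J ->
  (m / 2) ^+ #|S| * #|transversals (J :\: S)|%:R <= #|transversals J|%:R.
Proof.
have [k] := ubnP #|S|; elim: k S => // k IH S; rewrite ltnS => Sk SJ.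
have [->|[b bS]] := set_0Vmem S; first by rewrite cards0 expr0 mul1r setD0.
have cS : #|S| = #|S :\ b|.+1 by rewrite (cardsD1 b) bS.
apply: le_trans (IH (S :\ b) _ _); last first.
- by apply: subset_trans SJ; apply: subD1set.
- by rewrite cS in Sk.
rewrite cS exprSr -mulrA ler_wpM2l ?exprn_ge0 ?divr_ge0 ?(ltW m_gt0) //.
have -> : J :\: (S :\ b) = b |: (J :\: S).
  apply/setP => i; rewrite !inE; case: eqP => //= -> ; exact: (subsetP SJ).
by apply: card_transversals_extend; rewrite inE bS.
Qed.

Lemma card_transversals_gt0 J : (0 < #|transversals J|)%N.
Proof.
have := card_transversals_extend_set (subxx J); rewrite setDv.
have -> : transversals set0 = [set [ffun=> e0]].
  apply/setP => f; rewrite [RHS]inE; apply/transversalP/eqP => [[_ h _]|->].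
    by apply/ffunP => i; rewrite ffunE h ?inE.
  by split=> [i|i _|i j]; rewrite ?inE ?ffunE.
rewrite cards1 mulr1 -(ltr_nat R); apply: lt_le_trans.
by rewrite exprn_gt0 // divr_gt0.
Qed.

(** Forgetting [S] gives transversals of the complement of [S], and restoring each slot multiplies
    their number by at least [m / 2]. A uniform transversal thus behaves, up to constants, like
    independent choices. *)
Lemma card_transversals_spread (S : {set I}) (g : I -> E) :
  #|[set f in transversals [set: I] | [forall i in S, f i == g i]]|%:R
    <= (2 / m) ^+ #|S| * #|transversals [set: I]|%:R.
Proof.
have H := card_transversals_extend_set (subsetT S).
apply: le_trans (_ : #|transversals ([set: I] :\: S)|%:R <= _).
  by rewrite ler_nat card_transversals_prescribed // subsetT.
rewrite -ler_pdivrMl ?exprn_gt0 ?divr_gt0 //.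
by rewrite -exprVn invf_div.
Qed.

End Transversals.

(* Greedy choice; it uses [(1 - x) (1 + (s + 1) x) <= 1 + s x]. *)
Lemma greedy_hitting (R : realFieldType) (W E : finType) (hit : W -> {set E})
    (H : {set E}) (O : {set W}) (K M : R) (s : nat) :
  0 < K -> 0 < M -> #|H|%:R <= M -> {in O, forall w, K <= #|hit w :&: H|%:R} ->
  exists E1 : {set E}, [/\ E1 \subset H, (#|E1| <= s)%N &
    #|[set w in O | [disjoint hit w & E1]]|%:R * (s%:R * K) <= M * #|O|%:R].
Proof.
move=> K0 M0 HM hO.
(* The induction carries a stronger bound, with [M + s * K] in place of [s * K], which is meaningful
   already for [s = 0]. *)
suff [E1 [h1 h2 h3]] : exists E1 : {set E}, [/\ E1 \subset H, (#|E1| <= s)%N &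
    #|[set w in O | [disjoint hit w & E1]]|%:R * (M + s%:R * K) <= M * #|O|%:R].
  exists E1; split => //; apply: le_trans h3.
  by rewrite ler_wpM2l // lerDr ltW.
elim: s => [|s [E1 [E1H E1s IH]]].
  exists set0; split; rewrite ?sub0set ?cards0 //.
  rewrite mul0r addr0 mulrC ler_wpM2l ?(ltW M0) // ler_nat.
  by apply/subset_leq_card/subsetP => w; rewrite inE => /andP[].
set U := [set w in O | _] in IH.
have [U0|[w0 w0U]] := set_0Vmem U.
  exists E1; split => //; first exact: leqW.
  by rewrite -/U U0 cards0 mul0r mulr_ge0 // ltW.
pose cnt e := #|[set w in U | e \in hit w]|.
have /set0Pn[e0] : hit w0 :&: H != set0.
  have := hO w0; rewrite -card_gt0 -(ltr_nat R) => /(_ _)/(lt_le_trans K0); apply.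
  by move: w0U; rewrite inE => /andP[].
rewrite inE => /andP[_ e0H].
(* The best [e] hits at least the average number of the unhit elements, which is at least
   [K * #|U| / M]. *)
have [e eH emax] : exists2 e, e \in H & forall e', e' \in H -> (cnt e' <= cnt e)%N.
  by case: (@arg_maxnP _ e0 (mem H) cnt e0H) => e eH emax; exists e.
have cntE : K * #|U|%:R <= M * (cnt e)%:R.
  apply: (@le_trans _ _ (\sum_(w in U) #|hit w :&: H|%:R)).
    rewrite mulr_natr -sumr_const; apply: ler_sum => w; rewrite inE => /andP[wO _].
    exact: hO.
  have -> : \sum_(w in U) #|hit w :&: H|%:R = \sum_(e' in H) (cnt e')%:R :> R.
    transitivity (\sum_(w in U) \sum_(e' in H | e' \in hit w) (1 : R)).
      apply: eq_bigr => w _; rewrite -sumr_const; apply: eq_bigl => e'.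
      by rewrite inE andbC.
    rewrite (exchange_big_dep (mem H)) /=; last by move=> w e' _ /andP[].
    apply: eq_bigr => e' e'H; rewrite -sumr_const; apply: eq_bigl => w.
    by rewrite [in RHS]inE; congr (_ && _); apply/idP/idP; [case/andP|rewrite e'H].
  apply: (@le_trans _ _ (#|H|%:R * (cnt e)%:R)); last by rewrite ler_wpM2r.
  by rewrite mulr_natl -sumr_const; apply: ler_sum => e' e'H; rewrite ler_nat emax.
exists (e |: E1); split.
- by rewrite subUset sub1set eH.
- by rewrite cardsU1; case: (_ \notin _) => //=; apply: leqW.
have : (#|[set w in O | [disjoint hit w & e |: E1]]| + cnt e <= #|U|)%N.
  rewrite -cardsUI [X in (_ + X)%N](_ : _ = 0%N) ?addn0.
    apply/subset_leq_card/subsetP => w; rewrite !inE => /orP[|/andP[] //].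
    by move=> /andP[-> /=]; apply: disjointWr; apply: subsetUr.
  apply/eqP; rewrite cards_eq0; apply/eqP/setP => w; rewrite !inE.
  apply/negP => /andP[/andP[_ dj] /andP[_ ew]].
  by have := disjointFl dj (setU11 e E1); rewrite ew.
rewrite -(ler_nat R) natrD -natr1 mulrDl mul1r.
move: IH cntE; set u := #|U|%:R; set c := (cnt e)%:R; set o := #|O|%:R; set v := #|_|%:R.
have v0 : 0 <= v by exact: ler0n.
have s0 : 0 <= s%:R :> R by exact: ler0n.
move: (s%:R) s0 => x x0 IH ce vc; apply: le_trans IH.
have h : M * v <= (M - K) * u by nra.
have X0 : 0 <= M + (x * K + K) by nra.
have u0 : 0 <= u by exact: ler0n.
rewrite -(ler_pM2l M0).
have : (M * v) * (M + (x * K + K)) <= ((M - K) * u) * (M + (x * K + K)) by rewrite ler_wpM2r.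
suff : 0 <= u * (x * K * K + K * K) by nra.
by rewrite mulr_ge0 // addr_ge0 ?mulr_ge0 // ltW.
Qed.

(** * Rotations *)

Definition adj (n : nat) (R : {set {set 'I_n}}) : rel 'I_n :=
  fun x y => [set x; y] \in R.

Definition is_path (n : nat) (R : {set {set 'I_n}}) (s : seq 'I_n) : bool :=
  uniq s && sorted (adj R) s.

Definition nbhd (n : nat) (R : {set {set 'I_n}}) (S : {set 'I_n}) : {set 'I_n} :=
  [set z | [exists x in S, adj R x z]] :\: S.

Definition expander (n : nat) (k : nat) (R : {set {set 'I_n}}) : Prop :=
  forall S : {set 'I_n}, S != set0 -> (#|S| <= k)%N -> (2 * #|S| < #|nbhd R S|)%N.

(** Sequences of Posa rotations with the first vertex fixed: the edge from [u] to the old end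
    replaces the edge from [u] to its successor, which becomes the new end. *)
Inductive rotation (n : nat) (R : {set {set 'I_n}}) (s : seq 'I_n) : seq 'I_n -> Prop :=
| rotation_refl : rotation R s s
| rotation_step a u q : rotation R s (a ++ u :: q) -> adj R u (last u q) ->
    rotation R s (a ++ u :: rev q).

Lemma adjC n (R : {set {set 'I_n}}) x y : adj R x y = adj R y x.
Proof. by rewrite /adj setUC. Qed.

Lemma adj_neq n (R : {set {set 'I_n}}) x y : R \subset pairs n -> adj R x y -> x != y.
Proof. by move=> /subsetP RP /RP; rewrite inE cards2; case: (x == y). Qed.

Lemma sorted_cat_cons (T : eqType) (e : rel T) a u q :
  sorted e (a ++ u :: q) = sorted e (rcons a u) && path e u q.
Proof.
case: a => //= x a.
by rewrite cat_path rcons_path /= andbA.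
Qed.

Lemma sorted_rotation (T : eqType) (e : rel T) a u q : symmetric e ->
  sorted e (a ++ u :: q) -> e u (last u q) -> sorted e (a ++ u :: rev q).
Proof.
move=> es; rewrite !sorted_cat_cons => /andP[-> /=].
case/lastP: q => //= q t; rewrite last_rcons rev_rcons /= => pq ->.
have: sorted e (rcons q t) by move: pq; case: (q) => //= ? ? /andP[].
rewrite -[sorted e (rcons q t)]rev_sorted rev_rcons.
by rewrite (eq_sorted (e' := e)).
Qed.

(** * Posa's lemma on the ends of rotated longest paths *)

Section Posa.
Variables (n : nat) (R : {set {set 'I_n}}) (y : 'I_n) (t : seq 'I_n).
Hypothesis RP : R \subset pairs n.
Hypothesis path0 : is_path R (y :: t).
Hypothesis longest0 : forall s, is_path R s -> (size s <= size (y :: t))%N.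
Let s0 := y :: t.

Definition rotation_ends : {set 'I_n} :=
  [set x | `[< exists2 s, rotation R s0 s & last y s = x >]].

Lemma rotationP s : rotation R s0 s ->
  [/\ is_path R s, perm_eq s s0 & exists s', s = y :: s'].
Proof.
elim => [|a u q _ [/andP[us ss] ps [s' es]] uq]; first by split=> //; exists t.
have pq : perm_eq (a ++ u :: rev q) (a ++ u :: q).
  by rewrite perm_cat2l perm_cons perm_rev.
split.
- rewrite /is_path (perm_uniq pq) us /=; apply: sorted_rotation => // x x'; exact: adjC.
- exact: perm_trans pq ps.
- by case: a es {us ss ps pq} => [|x a] [<- _]; [exists (rev q)|exists (a ++ u :: rev q)].
Qed.

(** Neighbours are taken cyclically, so an end of the path also gets the opposite end. This is
    harmless, since only the bound of two neighbours per vertex is needed. *)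
Definition next_or_prev (z : 'I_n) : {set 'I_n} := [set next s0 z; prev s0 z].

(** A path sorted for this relation has next to [z] only vertices that are next to [z] on the
    initial path. *)
Let protected (z : 'I_n) : rel 'I_n := fun x x' =>
  ((x == z) ==> (x' \in next_or_prev z)) && ((x' == z) ==> (x \in next_or_prev z)).

Let protectedC z : symmetric (protected z).
Proof. by move=> x x'; rewrite /protected andbC. Qed.

Let uniq0 : uniq s0. Proof. by case/andP: path0. Qed.

Let protected0 z : sorted (protected z) s0.
Proof.
have /= := cycle_next uniq0; rewrite rcons_path => /andP[+ _].
apply: sub_path => x x' /eqP <-; rewrite /protected; apply/andP; split; apply/implyP => /eqP.
  by move=> ->; rewrite !inE eqxx.
by move=> <-; rewrite !inE prev_next // eqxx orbT.
Qed.

(* The edges of the initial path at [z] survive all rotations as long as neither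
   [z] nor a neighbour of [z] on that path becomes an end. *)
Let protected_rotation z s : rotation R s0 s -> z \notin rotation_ends ->
  [disjoint next_or_prev z & rotation_ends] -> sorted (protected z) s.
Proof.
move=> rs zS dj; elim: rs => // a u q r sp uq.
have r' := rotation_step r uq.
have qe : q != [::] by case: (q) uq => //= /(adj_neq RP); rewrite eqxx.
apply: sorted_rotation => //; rewrite /protected.
(* The only new adjacency joins [u] to the old end. If the old end is [z], then [z] is in
   [rotation_ends]; if [u] is [z], its successor [h] is both an initial neighbour of [z] and a new
   end. *)
apply/andP; split; apply/implyP => /eqP e; last first.
  move: zS; rewrite inE => /asboolPn[]; exists (a ++ u :: q) => //.
  by rewrite last_cat.
case: q qe r r' sp {uq} => // h q _ r r' sp.
have hS : h \in rotation_ends.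
  rewrite inE; apply/asboolP; exists (a ++ u :: rev (h :: q)) => //.
  by rewrite last_cat /= rev_cons last_rcons.
move: sp; rewrite sorted_cat_cons => /andP[_ /= /andP[/andP[+ _] _]].
rewrite e eqxx /= => hz.
by have := disjointFl dj hS; rewrite hz.
Qed.

(** Let [z] be adjacent to an end [x] without being an end. If no initial neighbour of [z] were an
    end, [z] would keep its initial neighbours on the path ending in [x], and rotating at [z] would
    turn one of them into an end. *)
Lemma nbhd_rotation_ends :
  nbhd R rotation_ends \subset next s0 @: rotation_ends :|: prev s0 @: rotation_ends.
Proof.
apply/subsetP => z; rewrite in_setD => /andP[zS]; rewrite inE => /exists_inP[x xS xz].
have [dj|] := boolP [disjoint next_or_prev z & rotation_ends]; last first.
  rewrite -setI_eq0 => /set0Pn[h]; rewrite inE in_set2 => /andP[/orP[]/eqP -> hS]; rewrite in_setU; apply/orP.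
    by right; apply/imsetP; exists (next s0 z); rewrite ?prev_next.
  by left; apply/imsetP; exists (prev s0 z); rewrite ?next_prev.
move: xS; rewrite inE => /asboolP[s rs lx].
have [/andP[us ss] ps [s' es]] := rotationP rs.
(* Otherwise appending [z] would give a longer path. *)
have zs : z \in s.
  apply/negPn/negP => zs.
  have /longest0 : is_path R (rcons s z).
    rewrite /is_path rcons_uniq zs us /= es /= rcons_path.
    by move: ss lx; rewrite es /= => -> ->.
  by rewrite size_rcons (perm_size ps) ltnn.
have sp := protected_rotation rs zS dj.
case/splitPr: zs rs lx sp => a q r lx sp.
have lq : last z q = x by rewrite -lx last_cat.
have uq : adj R z (last z q) by rewrite lq adjC.
have r' := rotation_step r uq.
case: q lq uq r r' sp {lx} => [|h q] lq uq r r' sp.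
  by move: uq => /(adj_neq RP); rewrite eqxx.
have hS : h \in rotation_ends.
  rewrite inE; apply/asboolP; exists (a ++ z :: rev (h :: q)) => //.
  by rewrite last_cat /= rev_cons last_rcons.
move: sp; rewrite sorted_cat_cons => /andP[_ /= /andP[/andP[+ _] _]].
rewrite eqxx /= => hz.
by have := disjointFl dj hS; rewrite hz.
Qed.

Lemma card_rotation_ends k : expander k R -> (k < #|rotation_ends|)%N.
Proof.
move=> ex; rewrite ltnNge; apply/negP => Sk.
have S0 : rotation_ends != set0.
  apply/set0Pn; exists (last y s0); rewrite inE; apply/asboolP.
  by exists s0 => //; apply: rotation_refl.
have := ex _ S0 Sk; rewrite ltnNge => /negP; apply.
apply: leq_trans (subset_leq_card nbhd_rotation_ends) _.
apply: leq_trans (leq_card_setU _ _) _.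
by rewrite mul2n -addnn leq_add // leq_imset_card.
Qed.

End Posa.

(** * Longest paths on a fixed vertex set, with varying ends *)

Section LongestPath.
Variables (n : nat) (R : {set {set 'I_n}}).

(** The choice depends on [R] alone, as do [linked], [link] and [before] below. A union bound over
    [R] therefore covers everything derived from the path. *)
Definition longest : seq 'I_n :=
  xget [::] (fun s => is_path R s /\ forall s', is_path R s' -> (size s' <= size s)%N).

Lemma longestP : is_path R longest /\
  forall s', is_path R s' -> (size s' <= size longest)%N.
Proof.
apply: (@xgetPex _ [::] (fun s => is_path R s /\ forall s', is_path R s' -> (size s' <= size s)%N)).
have us s : is_path R s -> (size s <= n)%N.
  by move=> /andP[us _]; rewrite -[leqRHS]card_ord -(card_uniqP us) max_card.
pose P k := `[< exists2 s, is_path R s & size s = k >].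
have P0 : exists k, P k by exists 0%N; apply/asboolP; exists [::].
have Pn k : P k -> (k <= n)%N by move=> /asboolP[s /us + <-].
case: (ex_maxnP P0 Pn) => k /asboolP[s sp sk] kmax; exists s; split=> // s' s'p.
by rewrite sk; apply: kmax; apply/asboolP; exists s'.
Qed.

Definition spans (x y : 'I_n) (t : seq 'I_n) : bool :=
  [&& is_path R (x :: t), [set z in x :: t] == [set z in longest] & last x t == y].

Definition linked (x y : 'I_n) : bool := `[< exists t, spans x y t >].

(** The default [[::]] keeps [x :: link x y] free of repetitions even for unlinked pairs, so that
    [before] is always injective. *)
Definition link (x y : 'I_n) : seq 'I_n := xget [::] (fun t => spans x y t).

Lemma linkP x y : linked x y -> spans x y (link x y).
Proof. by move=> /asboolP; apply: (@xgetPex _ [::] (fun t => spans x y t)). Qed.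

Lemma uniq_link x y : uniq (x :: link x y).
Proof.
have [|h] := boolP (linked x y); first by move=> /linkP/and3P[/andP[]].
suff -> : link x y = [::] by [].
rewrite /link; case: xgetP => // t _ h'; case/negP: h; apply/asboolP; by exists t.
Qed.

Lemma linkedC : symmetric linked.
Proof.
suff H x y : linked x y -> linked y x by move=> x y; apply/idP/idP; apply: H.
move=> /asboolP[t /and3P[/andP[up sp] /eqP vs /eqP lt]]; apply/asboolP.
have [b hd] : exists b, rev (x :: t) = y :: b.
  by exists (rev (belast x t)); rewrite [x :: t]lastI rev_rcons lt.
have pe : perm_eq (y :: b) (x :: t) by rewrite -hd perm_rev.
exists b; rewrite /spans /is_path (perm_uniq pe) up -hd rev_sorted.
apply/and3P; split.
- by rewrite (eq_sorted (e' := adj R)) // => ? ?; apply: adjC.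
- by rewrite -vs; apply/eqP/setP => z; rewrite !inE mem_rev inE.
- have : last y (rev (x :: t)) = x by rewrite rev_cons last_rcons.
  by rewrite hd /= => ->.
Qed.

(* The predecessor of [w] on the chosen path from [x] to [y]; it is [y] for [w = x]
   and [w] itself off the path. *)
Definition before (y x w : 'I_n) : 'I_n := prev (x :: link x y) w.

Lemma before_inj y x : injective (before y x).
Proof. exact: can_inj (next_prev (uniq_link x y)). Qed.

Lemma spans_longest x y t : spans x y t -> size (x :: t) = size longest.
Proof.
move=> /and3P[/andP[up _] /eqP vs _].
have /andP[ul _] := longestP.1.
rewrite -(card_uniqP up) -(card_uniqP ul).
by have := congr1 (fun A : {set _} => #|A|) vs; rewrite !cardsE.
Qed.

(** Rotations of a path starting at [x] preserve [x] and the vertex set, so all their ends are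
    linked to [x]. *)
Lemma card_linked k x y : R \subset pairs n -> expander k R -> linked x y ->
  (k < #|[set z | linked x z]|)%N.
Proof.
move=> RP ex /asboolP[t st]; have /and3P[pt /eqP vs _] := st.
have lt s : is_path R s -> (size s <= size (x :: t))%N.
  by rewrite (spans_longest st); apply: longestP.2.
apply: leq_trans (card_rotation_ends RP pt lt ex) _.
apply/subset_leq_card/subsetP => z; rewrite !inE => /asboolP[s rs lz].
have [ps pe [s' es]] := rotationP pt rs.
apply/asboolP; exists s'; rewrite /spans -es ps -vs /=; apply/andP; split.
  by apply/eqP/setP => w; rewrite inE [RHS]inE (perm_mem pe).
by rewrite -lz es.
Qed.

Lemma linked_exists : (0 < n)%N -> exists x y, linked x y.
Proof.
move=> n0; have [lp lm] := longestP.
have : (0 < size longest)%N by apply: (lm [:: Ordinal n0]).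
case E: longest => [|x t] // _; exists x, (last x t); apply/asboolP.
by exists t; rewrite /spans E eqxx -E lp /=.
Qed.

End LongestPath.

(** * Double counting *)

Lemma set2_eq (T : finType) (a b x y : T) :
  [set x; y] = [set a; b] -> (x = a /\ y = b) \/ (x = b /\ y = a).
Proof.
move=> E.
have: x \in [set a; b] by rewrite -E set21.
have: y \in [set a; b] by rewrite -E set22.
have: a \in [set x; y] by rewrite E set21.
have: b \in [set x; y] by rewrite E set22.
rewrite !inE => /orP[]/eqP-> /orP[]/eqP-> /orP[]/eqP h1 /orP[]/eqP h2; subst; by [left|right].
Qed.

Lemma card_ordered_edges (T : finType) (D : {set T * T}) :
  (#|D| <= 2 * #|[set [set u.1; u.2] | u in D]|)%N.
Proof.
set E := [set _ | _ in D].
have DE : D \subset \bigcup_(e in E) [set u | [set u.1; u.2] == e].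
  apply/subsetP => u uD; apply/bigcupP; exists [set u.1; u.2]; last by rewrite inE.
  exact: imset_f.
apply: leq_trans (subset_leq_card DE) _.
apply: leq_trans (leq_card_bigcup _ _) _.
rewrite mulnC -sum_nat_const; apply: leq_sum => e /imsetP[[a b] _ ->] /=.
apply: leq_trans (_ : #|[set (a, b); (b, a)]| <= _)%N; last by rewrite cards2; case: (_ != _).
apply/subset_leq_card/subsetP => -[x y]; rewrite inE /= => /eqP /set2_eq[] [-> ->].
  exact: set21.
exact: set22.
Qed.

Section Counting.
Variables (F : realFieldType) (n : nat).
Implicit Types (E : {set {set 'I_n}}) (x y v w : 'I_n).

(* Every edge is counted in both directions. *)
Definition dirsum E (u : 'I_n -> 'I_n -> F) : F := \sum_x \sum_(w | adj E x w) u x w.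

Definition arcs E : {set 'I_n * 'I_n} := [set a | adj E a.1 a.2].

Lemma dirsum_arcs E u : dirsum E u = \sum_(a in arcs E) u a.1 a.2.
Proof.
rewrite /dirsum pair_big_dep /=; apply: eq_bigl => a; by rewrite inE.
Qed.

Lemma card_arcs_le E : (#|arcs E| <= 2 * #|E|)%N.
Proof.
apply: leq_trans (card_ordered_edges _) _; rewrite leq_mul2l /=.
by apply/subset_leq_card/subsetP => _ /imsetP[a + ->]; rewrite inE.
Qed.

Lemma card_arcs_ge E : E \subset pairs n -> (#|E| <= #|arcs E|)%N.
Proof.
move=> /subsetP EP.
apply: leq_trans (leq_imset_card (fun a : 'I_n * 'I_n => [set a.1; a.2]) (arcs E)).
apply/subset_leq_card/subsetP => e eE; have := EP _ eE; rewrite inE => /cards2P[x [y [_ ee]]].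
by apply/imsetP; exists (x, y) => //=; rewrite inE /adj /= -ee.
Qed.

Lemma card_same_colour (K : eqType) (c : {set 'I_n} -> K) (k : F) (H R : {set {set 'I_n}}) :
  (forall a, #|[set e in H | c e == a]|%:R <= k) ->
  #|[set e in H | c e \in [seq c f | f in R]]|%:R <= #|R|%:R * k.
Proof.
move=> ck.
have sub : [set e in H | c e \in [seq c f | f in R]] \subset
    \bigcup_(f in R) [set e in H | c e == c f].
  apply/subsetP => e; rewrite inE => /andP[eH /imageP[f fR cf]].
  by apply/bigcupP; exists f => //; rewrite inE eH cf eqxx.
apply: (@le_trans _ _ (\sum_(f in R) #|[set e in H | c e == c f]|)%:R).
  by rewrite ler_nat; apply: leq_trans (subset_leq_card sub) (leq_card_bigcup _ _).
by rewrite natr_sum mulr_natl -sumr_const; apply: ler_sum => f _; apply: ck.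
Qed.

(** The degree, as soon as [E] consists of pairs, written as one row of a [dirsum]. *)
Definition outdeg E x : F := \sum_(w | adj E x w) 1.

Lemma outdeg_split (E E' : {set {set 'I_n}}) x : E' \subset E ->
  outdeg E x = outdeg E' x + outdeg (E :\: E') x.
Proof.
move=> /subsetP sub; rewrite /outdeg (bigID (adj E' x)) /=; congr (_ + _).
  by apply: eq_bigl => w; rewrite andbC; case: (boolP (adj E' x w)) => //= /sub.
by apply: eq_bigl => w; rewrite /adj inE andbC.
Qed.

Lemma sum_outdeg_le E : \sum_x outdeg E x <= 2 * #|E|%:R.
Proof.
rewrite -[X in X <= _]/(dirsum E (fun _ _ => 1)) dirsum_arcs sumr_const.
by rewrite -natrM ler_nat card_arcs_le.
Qed.

(** * Existence of two differently coloured edges that close a longest path *)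

Section Booster.
Variables (K : eqType) (c : {set 'I_n} -> K).
Variables (Q : rel 'I_n) (bf : 'I_n -> 'I_n -> 'I_n -> 'I_n).
Variables (G H H1 : {set {set 'I_n}}) (D1 : nat) (eps p mu gam sig : F).
Let N : F := n%:R.
Let q x : F := #|[set z | Q x z]|%:R.

(* The [v] such that some [xw] in [R1], [v] being the predecessor of [w] on the path
   from [x] to [y], would make an edge [yv] close this path to a cycle. *)
Definition hit (R1 : {set {set 'I_n}}) y : {set 'I_n} :=
  [set v | [exists x, Q x y && [exists w, adj R1 x w && (bf y x w == v)]]].

Hypothesis HG : H \subset G.
Hypothesis H1H : H1 \subset H.
Hypothesis n0 : (0 < n)%N.
Hypothesis p0 : 0 < p.
Hypothesis gam0 : 0 < gam.
Hypothesis mu0 : 0 <= mu.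
Hypothesis eps0 : 0 < eps.
Hypothesis degH : forall x, (2^-1 + eps) * p * N <= outdeg H x.
Hypothesis lost1 : #|H :\: H1|%:R <= 12 * mu * p * N ^+ 2.
Hypothesis col_le : forall a, #|[set e in H | c e == a]|%:R <= mu * p * N.
Hypothesis cardG : #|G|%:R <= 2 * p * N ^+ 2.
Hypothesis HP1 : forall y (A : {set 'I_n}),
  dirsum G (fun x w => (Q x y && (bf y x w \in A))%:R)
    <= p * q y * #|A|%:R + gam * p * N ^+ 2.
Hypothesis HP2 : forall R1 : {set {set 'I_n}}, R1 \subset H1 -> (#|R1| <= D1 * n)%N ->
  dirsum G (fun y v => if v \in hit R1 y then 0 else q y / N)
    <= p * \sum_y q y / N * (N - #|hit R1 y|%:R) + gam * p * N ^+ 2.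
Hypothesis Qbig : sig ^+ 2 * N ^+ 2 <= \sum_x q x.
Hypothesis D1_ge : 4 <= D1%:R * gam ^+ 2.
Hypothesis small : 4 * gam + (48 + 2 * D1%:R) * mu < 2 * eps * sig ^+ 2.

Let N0 : 0 < N. Proof. by rewrite ltr0n. Qed.

Let q_ge0 x : 0 <= q x. Proof. exact: ler0n. Qed.
Let q_leN x : q x <= N.
Proof. by rewrite ler_nat -[leqRHS]card_ord max_card. Qed.

(** The directed edges [xw] that close a path from [x] to [y] in company with the edge [yv]. *)
Let fan y v : {set 'I_n * 'I_n} :=
  [set a in arcs H1 | Q a.1 y && (bf y a.1 a.2 == v)].
Let X y v : F := #|fan y v|%:R.
(** The threshold is such that for each [y] the [v] outside [A y] contribute at most
    [gam * p * N ^+ 2] to the sum of the fan sizes. *)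
Let A y : {set 'I_n} := [set v | gam * p * N <= X y v].

Let sumX y : \sum_v X y v = \sum_(x | Q x y) outdeg H1 x.
Proof.
transitivity (\sum_(a in arcs H1) (Q a.1 y)%:R : F).
  under eq_bigr => v _ do rewrite /X -sum1_card natr_sum.
  transitivity (\sum_v \sum_(a in arcs H1 | bf y a.1 a.2 == v) (Q a.1 y)%:R : F).
    apply: eq_bigr => v _; rewrite [RHS](bigID (fun a => Q a.1 y)) /= [X in _ + X]big1 ?addr0.
      apply: eq_big => a; first by rewrite inE; case: (a \in _) => //=; rewrite andbC.
      by rewrite inE => /and3P[_ -> _].
    by move=> a /andP[_ /negbTE ->].
  rewrite (exchange_big_dep (mem (arcs H1))) /=; last by move=> v a _ /andP[].
  apply: eq_bigr => a aH; rewrite (big_pred1 (bf y a.1 a.2)) // => v.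
  by rewrite aH /= eq_sym.
rewrite -(dirsum_arcs H1 (fun x w => (Q x y)%:R)) /dirsum [LHS](bigID (fun x => Q x y)) /=.
rewrite [X in _ + X]big1 ?addr0; last by move=> x /negbTE ->; rewrite big1.
by apply: eq_bigr => x ->.
Qed.

Let double_sum (f : 'I_n -> F) : \sum_y \sum_(x | Q x y) f x = \sum_x q x * f x.
Proof.
rewrite (exchange_big_dep xpredT) //=; apply: eq_bigr => x _.
rewrite sumr_const mulr_natl; congr (_ *+ _); apply: eq_card => y; by rewrite !inE.
Qed.

(** Each edge missing from [H'] is counted at both ends, with a weight [q] of at most [N]. *)
Let degsum (H' : {set {set 'I_n}}) (l : F) : H' \subset H -> #|H :\: H'|%:R <= l ->
  (2^-1 + eps) * p * N * \sum_x q x - 2 * l * N <= \sum_x q x * outdeg H' x.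
Proof.
move=> H'H ll; rewrite lerBlDr mulr_sumr.
apply: (@le_trans _ _ (\sum_x (q x * outdeg H' x + N * outdeg (H :\: H') x))).
  apply: ler_sum => x _; apply: (@le_trans _ _ (outdeg H x * q x)).
    by rewrite ler_wpM2r.
  rewrite (outdeg_split x H'H) mulrC mulrDr lerD2l ler_wpM2r //.
  exact: sumr_ge0.
rewrite big_split /= lerD2l -mulr_sumr mulrC ler_wpM2r ?(ltW N0) //.
by apply: le_trans (sum_outdeg_le _) _; rewrite ler_wpM2l.
Qed.

Lemma booster_exists : exists x y w,
  [/\ Q x y, adj H1 x w, adj H1 y (bf y x w) & c [set x; w] != c [set y; bf y x w]].
Proof.
pose O : {set 'I_n * 'I_n} := [set u | u.2 \in A u.1].
pose ht (u : 'I_n * 'I_n) := [set [set a.1; a.2] | a in fan u.1 u.2].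
have htH u : ht u \subset H1.
  apply/subsetP => _ /imsetP[a + ->]; rewrite inE => /andP[+ _]; by rewrite inE.
(* The division by 2 is there because an edge may occur in a fan in both orientations. *)
have K0 : 0 < gam * p * N / 2 by rewrite divr_gt0 // !mulr_gt0.
have M0 : 0 < 2 * p * N ^+ 2 by rewrite !mulr_gt0 // exprn_gt0.
have HM : #|H1|%:R <= 2 * p * N ^+ 2.
  apply: le_trans cardG; rewrite ler_nat subset_leq_card //.
  exact: subset_trans H1H HG.
have hO : {in O, forall u, gam * p * N / 2 <= #|ht u :&: H1|%:R}.
  move=> u; rewrite inE inE => uA; rewrite (setIidPl (htH u)) ler_pdivrMr // [leRHS]mulrC -natrM.
  by apply: le_trans uA _; rewrite ler_nat card_ordered_edges.
have [R1 [R1H R1c unhit]] := greedy_hitting (D1 * n) K0 M0 HM hO.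
set U := [set w in O | _] in unhit.
(* With [D1 * n] edges the greedy choice leaves at most [4 * N ^+ 2 / (D1 * gam)] pairs unhit, and
   [D1_ge] applies. *)
have {}unhit : #|U|%:R <= gam * N ^+ 2.
  have O_le : #|O|%:R <= N ^+ 2 :> F.
    by rewrite -natrX ler_nat (leq_trans (max_card _)) // card_prod card_ord.
  have : 2 * p * N ^+ 2 * #|O|%:R <= 2 * p * N ^+ 2 * N ^+ 2 by rewrite ler_wpM2l // ltW.
  move=> /(le_trans unhit); rewrite natrM -/N.
  have -> : #|U|%:R * (D1%:R * N * (gam * p * N / 2)) = (2 * p * N ^+ 2) * (#|U|%:R * (D1%:R * gam) / 4) by field.
  rewrite ler_pM2l // => h.
  have h4 : #|U|%:R * 4 <= #|U|%:R * (D1%:R * gam ^+ 2) by rewrite ler_wpM2l.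
  have : #|U|%:R * (D1%:R * gam) / 4 * gam <= N ^+ 2 * gam by rewrite ler_wpM2r // ltW.
  by move: h4; set u := #|U|%:R; nra.
(* Removing the colours of [R1] makes an edge [yv] of [H2] differ in colour from the edge [xw] of
   [R1] that accompanies it. *)
pose H2 := [set e in H1 | c e \notin [seq c f | f in R1]].
have [/existsP[y /existsP[v /andP[yv vh]]]|no] :=
    boolP [exists y, exists v, adj H2 y v && (v \in hit R1 y)].
  move: vh; rewrite inE => /existsP[x /andP[xy /existsP[w /andP[xw /eqP bv]]]].
  move: yv; rewrite /adj inE => /andP[yv cv].
  exists x, y, w; rewrite bv; split => //; first exact: (subsetP R1H).
  apply: contraNneq cv => <-; apply/imageP; by exists [set x; w].
exfalso.
have H2H : H2 \subset H by apply: subset_trans H1H; apply/subsetP => e; rewrite inE => /andP[].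
pose S := \sum_x q x.
pose SA := \sum_y q y * #|A y|%:R.
pose SH := \sum_y q y * #|hit R1 y|%:R.
have a1 := degsum H1H lost1.
(* One error [gam] comes from the [v] outside [A y], the other from [HP1] applied to [A y]. *)
have a2 : \sum_x q x * outdeg H1 x <= 2 * gam * p * N ^+ 3 + p * SA.
  rewrite -double_sum.
  apply: (@le_trans _ _ (\sum_(y < n) (gam * p * N ^+ 2 + (p * q y * #|A y|%:R + gam * p * N ^+ 2)))).
    apply: ler_sum => y _; rewrite -sumX (bigID (mem (~: A y))) /=; apply: lerD.
      apply: (@le_trans _ _ (\sum_(v in ~: A y) gam * p * N)).
        by apply: ler_sum => v; rewrite !inE -ltNge => /ltW.
      rewrite sumr_const -mulr_natr.
      have -> : gam * p * N ^+ 2 = gam * p * N * N by ring.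
      rewrite ler_wpM2l ?mulr_ge0 ?(ltW p0) ?(ltW gam0) ?(ltW N0) //.
      by rewrite ler_nat -[leqRHS]card_ord max_card.
    apply: le_trans (HP1 y (A y)).
    rewrite dirsum_arcs.
    have -> : \sum_(v | v \notin ~: A y) X y v =
        \sum_(a in arcs H1) (Q a.1 y && (bf y a.1 a.2 \in A y))%:R.
      under eq_bigr => v _ do rewrite /X -sum1_card natr_sum.
      transitivity (\sum_(v in A y) \sum_(a in arcs H1 | bf y a.1 a.2 == v) (Q a.1 y)%:R : F).
        apply: eq_big => v; first by rewrite !inE negbK.
        move=> _; rewrite [RHS](bigID (fun a => Q a.1 y)) /= [X in _ + X]big1 ?addr0.
          apply: eq_big => a; first by rewrite inE; case: (a \in _) => //=; rewrite andbC.
          by rewrite inE => /and3P[_ -> _].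
        by move=> a /andP[_ /negbTE ->].
      rewrite (exchange_big_dep (mem (arcs H1))) /=; last by move=> v a _ /andP[].
      apply: eq_bigr => a aH; case: (boolP (bf y a.1 a.2 \in A y)) => bA; last first.
        rewrite andbF big_pred0 // => v; rewrite aH /=; apply/negbTE/negP => /andP[vA /eqP e].
        by rewrite e vA in bA.
      rewrite andbT (big_pred1 (bf y a.1 a.2)) // => v; rewrite aH /= eq_sym.
      by case: eqP => [->|]; rewrite ?bA ?andbF.
    rewrite [leRHS](bigID (mem (arcs H1))) /=.
    rewrite [X in X <= _](_ : _ = \sum_(a in arcs G | a \in arcs H1) (Q a.1 y && (bf y a.1 a.2 \in A y))%:R).
      by rewrite lerDl sumr_ge0 // => a _; apply: ler0n.
    apply: eq_bigl => a; rewrite andbC; case: (boolP (a \in arcs H1)) => //=; rewrite !inE.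
    by move=> /(subsetP H1H)/(subsetP HG); rewrite /adj => ->.
  rewrite big_split /= big_split /= !sumr_const card_ord -[_ *+ n]mulr_natr -/N /SA mulr_sumr.
  rewrite (eq_bigr (fun y => p * (q y * #|A y|%:R))); last by move=> y _; rewrite mulrA.
  set s := \sum_i _; nra.
(* A vertex of [A y] missed by [hit R1 y] yields a pair in [U]. *)
have a3 : SA <= SH + gam * N ^+ 3.
  apply: (@le_trans _ _ (SH + N * #|U|%:R)); last first.
    rewrite lerD2l (_ : gam * N ^+ 3 = N * (gam * N ^+ 2)); last by ring.
    by rewrite ler_wpM2l // ltW.
  have AU y : #|A y|%:R <= #|hit R1 y|%:R + #|[set v | (y, v) \in U]|%:R :> F.
    rewrite -natrD ler_nat; apply: leq_trans (leq_card_setU _ _).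
    apply/subset_leq_card/subsetP => v vA; rewrite inE.
    case: (boolP (v \in hit R1 y)) => //= vh; rewrite !inE /= -/(_ <= _) in vA *.
    rewrite vA /= disjoint_subset; apply/subsetP => e /imsetP[a + ->]; rewrite inE => /andP[_ /andP[aQ /eqP ab]].
    apply: contra vh => aR; rewrite inE; apply/existsP; exists a.1; rewrite aQ /=.
    by apply/existsP; exists a.2; rewrite ab eqxx andbT.
  apply: (@le_trans _ _ (\sum_y (q y * #|hit R1 y|%:R + N * #|[set v | (y, v) \in U]|%:R))).
    apply: ler_sum => y _; apply: le_trans (ler_wpM2l (q_ge0 y) (AU y)) _.
    by rewrite mulrDr lerD2l ler_wpM2r.
  rewrite big_split /= lerD2l -mulr_sumr ler_wpM2l ?(ltW N0) // -natr_sum ler_nat.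
  rewrite -[X in (_ <= X)%N]sum1_card (eq_bigl (fun u : 'I_n * 'I_n => xpredT u.1 && ((u.1, u.2) \in U))); last by case.
  rewrite -(pair_big_dep xpredT (fun y v => (y, v) \in U) (fun _ _ => 1%N)) /=.
  by apply: leq_sum => y _; rewrite -sum1_card; apply: eq_leq; apply: eq_bigl => v; rewrite inE.
have lost2 : #|H :\: H2|%:R <= (12 + D1%:R) * mu * p * N ^+ 2.
  have sub : H :\: H2 \subset (H :\: H1) :|: [set e in H | c e \in [seq c f | f in R1]].
    apply/subsetP => e; rewrite !inE; case: (e \in H) => //=; case: (e \in H1) => //=.
      by rewrite !andbT negbK.
    by rewrite ?andbF ?andbT.
  have := leq_trans (subset_leq_card sub) (leq_card_setU _ _); rewrite -(ler_nat F) natrD => h.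
  apply: le_trans h _.
  have -> : (12 + D1%:R) * mu * p * N ^+ 2 = 12 * mu * p * N ^+ 2 + D1%:R * mu * p * N ^+ 2 by ring.
  apply: lerD => //; apply: le_trans (card_same_colour R1 col_le) _.
  have -> : D1%:R * mu * p * N ^+ 2 = (D1 * n)%:R * (mu * p * N) by rewrite natrM -/N; ring.
  rewrite ler_wpM2r ?ler_nat // !mulr_ge0 // ?(ltW p0) ?(ltW N0) //.
have a4 := degsum H2H lost2.
(* By [no], all edges of [H2] at [y] lead outside [hit R1 y], where [HP2] counts them. The factor
   [N] undoes the normalisation of the weights in [HP2]. *)
have a5 : \sum_x q x * outdeg H2 x <= p * N * S - p * SH + gam * p * N ^+ 3.
  have := HP2 R1H R1c; rewrite -(ler_pM2l N0).
  have -> : N * (p * \sum_y q y / N * (N - #|hit R1 y|%:R) + gam * p * N ^+ 2) = p * N * S - p * SH + gam * p * N ^+ 3.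
    rewrite mulrDr; congr (_ + _); last by ring.
    rewrite /S /SH !mulr_sumr -sumrB; apply: eq_bigr => y _.
    by field; rewrite gt_eqF.
  apply: le_trans; rewrite /dirsum mulr_sumr; apply: ler_sum => y _.
  rewrite !mulr_sumr (bigID (adj H2 y)) /= [X in _ + X <= _](_ : _ = 0) ?addr0; last first.
    by rewrite big1 // => w /andP[h /negP[]].
  rewrite [leRHS](bigID (adj H2 y)) /=.
  rewrite [X in X <= _](_ : _ = \sum_(i | adj G y i && adj H2 y i) N * (if i \in hit R1 y then 0 else q y / N)).
    rewrite lerDl sumr_ge0 // => w _; case: ifP => // _; rewrite ?mulr0 //.
    by rewrite !mulr_ge0 ?invr_ge0 ?(ltW N0).
  apply: eq_big => w.
    rewrite andbb andbC; case: (boolP (adj H2 y w)) => //= /(subsetP H2H)/(subsetP HG).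
    by rewrite /adj => ->.
  move=> /andP[yw _]; case: ifP => [wh|_].
    by move/existsPn: no => /(_ y)/existsPn/(_ w); rewrite yw wh.
  by rewrite mulr1; field; rewrite gt_eqF.
have pN3 : 0 < p * N ^+ 3 by rewrite mulr_gt0 // exprn_gt0.
have a3' : p * SA <= p * SH + gam * p * N ^+ 3.
  have := ler_wpM2l (ltW p0) a3; rewrite mulrDr => h; apply: le_trans h _.
  by rewrite lerD2l le_eqVlt; apply/orP; left; apply/eqP; ring.
(* In the sum of [a1] to [a5] the two halves of [p * N * S] and the terms in [SA] and [SH] cancel.
   The errors are [gam] twice from [a2] and once from [a3] and [a5] each, and [24 * mu] and
   [(24 + 2 * D1) * mu] for the deleted edges. *)
have tot : 2 * eps * p * N * S <= (4 * gam + (48 + 2 * D1%:R) * mu) * (p * N ^+ 3).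
  move: a1 a2 a3' a4 a5; rewrite -/S; set s1 := \sum_x _; set s2 := \sum_x _.
  move=> a1 a2 a3' a4 a5.
  lra.
have : 2 * eps * p * N * (sig ^+ 2 * N ^+ 2) <= 2 * eps * p * N * S.
  by rewrite ler_wpM2l // !mulr_ge0 // ?(ltW eps0) ?(ltW p0) ?(ltW N0).
move=> /le_trans/(_ tot).
have -> : 2 * eps * p * N * (sig ^+ 2 * N ^+ 2) = (2 * eps * sig ^+ 2) * (p * N ^+ 3) by ring.
by rewrite ler_pM2r // leNgt small.
Qed.

End Booster.
End Counting.

(** * From a good graph to a rainbow Hamilton cycle *)

Lemma expanderS n k (R R' : {set {set 'I_n}}) : R \subset R' -> expander k R -> expander k R'.
Proof.
move=> /subsetP RR ex S S0 Sk; apply: leq_trans (ex S S0 Sk) _.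
apply/subset_leq_card/subsetP => z; rewrite !in_setD => /andP[-> /=]; rewrite !inE.
by move=> /exists_inP[x xS xz]; apply/exists_inP; exists x => //; apply: RR.
Qed.

Lemma is_pathS n (R R' : {set {set 'I_n}}) s : R \subset R' -> is_path R s -> is_path R' s.
Proof.
move=> /subsetP RR /andP[us ss]; rewrite /is_path us; apply: sub_sorted ss.
by move=> x y; apply: RR.
Qed.

Lemma prev_split (T : eqType) (x w : T) a b : uniq (x :: a ++ w :: b) ->
  prev (x :: a ++ w :: b) w = last x a.
Proof.
move=> u; rewrite -[RHS](prev_next u); congr prev.
have ix : index (last x a) (x :: a ++ w :: b) = size a.
  rewrite -cat_cons index_cat mem_last index_last //.
  by move: u; rewrite -cat_cons cat_uniq => /andP[].
by rewrite next_nth ix -cat_cons mem_cat mem_last nth_cat ltnn subnn.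
Qed.

(** With [v] the predecessor of [w], the cycle follows the path from [x] to [v], jumps to [y], runs
    back to [w] and returns to [x]. *)
Lemma close_cycle n (R' : {set {set 'I_n}}) x y w t : R' \subset pairs n ->
  is_path R' (x :: t) -> last x t = y -> w \in x :: t -> adj R' x w ->
  adj R' y (prev (x :: t) w) ->
  exists s, [/\ uniq s, s =i x :: t & cycle (adj R') s].
Proof.
move=> RP /andP[ut pt] lt wt xw yv.
have xw' := adj_neq RP xw.
have {wt} : w \in t by move: wt; rewrite inE eq_sym (negbTE xw').
move=> wt; case/splitPr: wt ut pt lt yv => a b ut pt lt.
rewrite prev_split // => yv.
exists (x :: a ++ rev (w :: b)); split.
- by rewrite -(perm_uniq (s1 := x :: a ++ w :: b)) // perm_cons perm_cat2l perm_sym perm_rev.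
- by move=> z; rewrite !inE !mem_cat mem_rev.
move: pt; rewrite /= cat_path => /andP[pa /= /andP[_ pb]].
rewrite rcons_cat cat_path pa /=.
have lb : last w b = y by rewrite -lt last_cat.
rewrite lastI rev_rcons lb /= adjC yv /= rcons_path.
have -> : path (adj R') y (rev (belast w b)).
  by rewrite -lb rev_path; apply: sub_path pb => u v; rewrite adjC.
have -> : last y (rev (belast w b)) = w.
  have : last y (rev (w :: b)) = w by rewrite rev_cons last_rcons.
  by rewrite lastI rev_rcons lb.
by rewrite adjC xw.
Qed.

(** Cut the cycle next to [u] and prepend [z]. *)
Lemma open_cycle n (R' : {set {set 'I_n}}) s u z : uniq s -> cycle (adj R') s ->
  u \in s -> z \notin s -> adj R' u z -> exists2 s', is_path R' s' & size s' = (size s).+1.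
Proof.
move=> us cs uS zS uz; case: (rot_to uS) => i s' es.
exists (z :: u :: s'); last by rewrite /= -(size_rot i s) es.
rewrite /is_path -es /= mem_rot zS rot_uniq us /=.
move: cs; rewrite -(rot_cycle i) es /= rcons_path => /andP[-> _].
by rewrite adjC uz.
Qed.

Lemma hamilton_cycle_edges n (H R' : {set {set 'I_n}}) s : (3 <= n)%N -> R' \subset H ->
  uniq s -> (forall x, x \in s) -> cycle (adj R') s ->
  hamilton_cycle H (cycle_edges s) /\ cycle_edges s \subset R'.
Proof.
move=> n3 RH us all cs.
have sub : cycle_edges s \subset R'.
  by apply/subsetP => _ /imsetP[x xs ->]; apply: (next_cycle cs).
split => //; split => //; exists s; split => //; exact: subset_trans RH.
Qed.

Lemma rainbow_setU1 n (K : eqType) (R : {set {set 'I_n}}) (c : {set 'I_n} -> K) e :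
  rainbow R c -> c e \notin [seq c f | f in R] -> rainbow (e |: R) c.
Proof.
move=> rR ce f g; rewrite !inE => /orP[/eqP->|fR] /orP[/eqP->|gR] // h.
- by case/negP: ce; rewrite h; apply/imageP; exists g.
- by case/negP: ce; rewrite -h; apply/imageP; exists f.
- exact: rR.
Qed.

Lemma rainbowS n (K : eqType) (R R' : {set {set 'I_n}}) (c : {set 'I_n} -> K) :
  R \subset R' -> rainbow R' c -> rainbow R c.
Proof. by move=> /subsetP RR r e f /RR eR /RR fR; apply: r. Qed.

(** * The properties of the random graph used by the deterministic argument *)

Section Properties.
Variables (F : realFieldType) (n : nat) (G : {set {set 'I_n}}) (p gam : F).
Local Notation N := (n%:R : F).

(** The first term on the right bounds the expectation, because [before] is injective in [w]. The
    size [12 * n] leaves room for the expander and for all edges added to it later. *)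
Definition sparse_fans := forall R : {set {set 'I_n}}, R \subset G -> (#|R| <= 12 * n)%N ->
  forall y (A : {set 'I_n}),
  dirsum G (fun x w => (linked R x y && (before R y x w \in A))%:R)
    <= p * #|[set z | linked R y z]|%:R * #|A|%:R + gam * p * N ^+ 2.

(** Division by [N] brings the weights into the unit interval, as the tail bound requires.
    Disjointness makes the probability factors of [R] and [R1] multiply in the union bound. *)
Definition sparse_misses (D1 : nat) := forall R R1 : {set {set 'I_n}}, R \subset G -> R1 \subset G ->
  [disjoint R & R1] -> (#|R| <= 12 * n)%N -> (#|R1| <= D1 * n)%N ->
  dirsum G (fun y v => if v \in hit (linked R) (before R) R1 y then 0
                       else #|[set z | linked R y z]|%:R / N)
    <= p * \sum_y #|[set z | linked R y z]|%:R / N * (N - #|hit (linked R) (before R) R1 y|%:R)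
       + gam * p * N ^+ 2.

Definition sparse_sets := forall A : {set 'I_n},
  dirsum G (fun x w => ((x \in A) && (w \in A))%:R) <= p * #|A|%:R ^+ 2 + gam * p * N ^+ 2.

(* The ways to choose six neighbours in [W] for each vertex of [S] so that the chosen
   edges are distinct; [e0] is a dummy value outside [S]. *)
Definition confined (e0 : 'I_n) (S W : {set 'I_n}) : {set {ffun 'I_n * 'I_6 -> 'I_n}} :=
  [set h : {ffun 'I_n * 'I_6 -> 'I_n} | [&& [forall i, if i.1 \in S then (h i \in W) && adj G i.1 (h i) else h i == e0]
      & [forall i, forall j, (i.1 \in S) ==> (j.1 \in S) ==>
           ([set i.1; h i] == [set j.1; h j]) ==> (i == j)]]].

(* The expected number of [S] whose six edges per vertex stay in a set of size
   [3 * #|S|], as [(4 / (p * N)) ^+ t] bounds the probability of [t] prescribed choices. *)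
Definition few_confined (e0 : 'I_n) (k : nat) : F :=
  \sum_(S : {set 'I_n} | (S != set0) && (#|S| <= k)%N) \sum_(W : {set 'I_n} | (#|W| == 3 * #|S|)%N)
     (4 / (p * N)) ^+ (6 * #|S|) * #|confined e0 S W|%:R.

End Properties.

Lemma extend_card (T : finType) (A : {set T}) m : (#|A| <= m <= #|T|)%N ->
  exists2 W : {set T}, A \subset W & #|W| = m.
Proof.
move=> /andP[]; have [j] := ubnP (m - #|A|); elim: j A => // j IH A jm Am mT.
case: (ltngtP #|A| m) Am => // [Am _|<- _]; last by exists A.
have /set0Pn[x] : ~: A != set0.
  by rewrite -card_gt0 cardsCs setCK subn_gt0; apply: leq_trans mT.
rewrite inE => xA.
have cA : #|x |: A| = #|A|.+1 by rewrite cardsU1 xA.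
case: (IH (x |: A)) => //; first by rewrite cA; lia.
  by rewrite cA.
by move=> W xW Wm; exists W => //; apply: subset_trans xW; apply: subsetUr.
Qed.

(** * Rainbow Hamilton cycles in graphs with these properties *)

Section Deterministic.
Variables (F : realFieldType) (n : nat) (K : eqType) (c : {set 'I_n} -> K).
Variables (G H : {set {set 'I_n}}) (e0 : 'I_n) (D1 k : nat) (eps p mu gam sig : F).
Let N : F := n%:R.

Hypothesis n3 : (3 <= n)%N.
Hypothesis GP : G \subset pairs n.
Hypothesis HG : H \subset G.
Hypothesis p0 : 0 < p.
Hypothesis gam0 : 0 < gam.
Hypothesis mu0 : 0 < mu.
Hypothesis eps0 : 0 < eps.
Hypothesis sig0 : 0 < sig.
Hypothesis gam1 : gam <= 1.
Hypothesis mu1 : 96 * mu <= 1.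
Hypothesis D1_ge : 4 <= D1%:R * gam ^+ 2.
Hypothesis small1 : 4 * gam + (48 + 2 * D1%:R) * mu < 2 * eps * sig ^+ 2.
Hypothesis small2 : gam + 24 * mu < eps * sig.
Hypothesis ksig : sig * N <= k.+1%:R.
Hypothesis k3 : (3 * k <= n)%N.
Hypothesis degH : forall x, (2^-1 + eps) * p * N <= outdeg F H x.
Hypothesis col_le : forall a, #|[set e in H | c e == a]|%:R <= mu * p * N.
Hypothesis fansG : sparse_fans G p gam.
Hypothesis missesG : sparse_misses G p gam D1.
Hypothesis setsG : sparse_sets G p gam.
Hypothesis confinedG : few_confined G p e0 k < 1.

Let N0 : 0 < N. Proof. by rewrite ltr0n; apply: leq_trans n3. Qed.

(** The slots are six copies of each vertex. If no transversal gave an expander, each would agree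
    with some confined choice on a small set [S], and summing the bounds of
    [card_transversals_spread] would give [1 <= few_confined G p e0 k]. *)
Lemma rainbow_expander_exists : exists R : {set {set 'I_n}},
  [/\ R \subset H, rainbow R c, (#|R| <= 6 * n)%N & expander k R].
Proof.
pose I := ('I_n * 'I_6)%type.
pose adm (i : I) : {set 'I_n} := [set w | adj H i.1 w].
pose col (i : I) w := c [set i.1; w].
pose m := p * N / 2.
have m0 : 0 < m by rewrite divr_gt0 // mulr_gt0.
have adm_ge i : m <= #|adm i|%:R.
  have := degH i.1; rewrite /outdeg sumr_const (@eq_card _ _ (adm i)); last by move=> w; rewrite inE.
  apply: le_trans; rewrite /m; have : 0 < eps * (p * N) by rewrite !mulr_gt0.
  lra.
(* An edge is available at its two ends, in six slots each. *)
have cl a : (\sum_i #|[set e in adm i | col i e == a]|)%:R <= 12 * (mu * p * N).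
  apply: le_trans (_ : (12 * #|[set e in H | c e == a]|)%:R <= _); last first.
    by rewrite natrM ler_wpM2l.
  rewrite ler_nat -(pair_bigA _ (fun v (j : 'I_6) => #|[set e in adm (v, j) | col (v, j) e == a]|)) /=.
  rewrite (eq_bigr (fun v => 6 * #|[set w | adj [set e in H | c e == a] v w]|)%N); last first.
    move=> v _; rewrite (eq_bigr (fun=> #|[set w | adj [set e in H | c e == a] v w]|)).
      by rewrite big_const_ord iter_addn_0 mulnC.
    by move=> j _; apply: eq_card => w; rewrite !inE /adj !inE.
  rewrite -big_distrr /= (_ : 12 = 6 * 2)%N // -mulnA leq_mul2l /=.
  apply: leq_trans (card_arcs_le _).
  rewrite -[leqRHS]sum1_card (eq_bigl (fun u : 'I_n * 'I_n => xpredT u.1 && adj [set e in H | c e == a] u.1 u.2)); last first.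
    by move=> u; rewrite inE.
  rewrite -(pair_big_dep xpredT (fun y v => adj [set e in H | c e == a] y v) (fun _ _ => 1%N)) /=.
  by apply: leq_sum => y _; rewrite -sum1_card; apply: eq_leq; apply: eq_bigl => v; rewrite inE.
have Dm : 4 * (12 * (mu * p * N)) <= m.
  rewrite /m; have : 0 < p * N by rewrite mulr_gt0.
  move: mu1; nra.
pose TT := transversals adm col e0 [set: I].
have T0 : (0 < #|TT|)%N by apply: (card_transversals_gt0 e0 m0 adm_ge cl Dm).
pose Rf (f : {ffun I -> 'I_n}) : {set {set 'I_n}} := [set [set i.1; f i] | i : I].
have good f : f \in TT -> [/\ Rf f \subset H, rainbow (Rf f) c & (#|Rf f| <= 6 * n)%N].
  move=> /transversalP[h1 _ h3]; split.
  - by apply/subsetP => _ /imsetP[i _ ->]; have := h1 i (in_setT _); rewrite inE.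
  - move=> _ _ /imsetP[i _ ->] /imsetP[j _ ->] h.
    case: (eqVneq i j) => [->//|ij].
    by have := h3 i j (in_setT _) (in_setT _) ij; rewrite /col h eqxx.
  - by apply: leq_trans (leq_imset_card _ _) _; rewrite card_prod !card_ord mulnC.
have [|none] := boolP [exists f in TT, `[< expander k (Rf f) >]].
  by move=> /exists_inP[f fT /asboolP ex]; exists (Rf f); have [] := good f fT.
exfalso; move: confinedG; rewrite ltNge => /negP; apply.
have T0' : 0 < #|TT|%:R :> F by rewrite ltr0n.
rewrite -(ler_pM2r T0') mul1r.
have cov : TT \subset \bigcup_(S : {set 'I_n} | (S != set0) && (#|S| <= k)%N)
    \bigcup_(W : {set 'I_n} | (#|W| == 3 * #|S|)%N) \bigcup_(h in confined G e0 S W)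
      [set f in TT | [forall i in setX S [set: 'I_6], f i == h i]].
  apply/subsetP => f fT; have [sH rf _] := good f fT.
  move/exists_inPn: none => /(_ f fT)/asboolPn.
  move=> /existsNP[S]; rewrite not_implyE => -[S0]; rewrite not_implyE => -[Sk] /negP; rewrite -leqNgt => bad.
  (* Non-expansion gives at most [3 * #|S|] vertices; padding to exactly this size is possible by
     [k3]. *)
  have [W sW cW] : exists2 W : {set 'I_n}, S :|: nbhd (Rf f) S \subset W & #|W| = (3 * #|S|)%N.
    apply: extend_card; rewrite card_ord; apply/andP; split.
      by apply: leq_trans (leq_card_setU _ _) _; rewrite -[3%N]/(1 + 2)%N mulnDl mul1n leq_add2l.
    by apply: leq_trans k3; rewrite leq_mul2l.
  apply/bigcupP; exists S; first by rewrite S0.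
  apply/bigcupP; exists W; first by rewrite cW.
  pose h : {ffun I -> 'I_n} := [ffun i => if i.1 \in S then f i else e0].
  have /transversalP[h1 _ h3] := fT.
  apply/bigcupP; exists h; last first.
    rewrite inE fT /=; apply/forall_inP => i; rewrite inE => /andP[iS _].
    by rewrite ffunE iS.
  rewrite inE; apply/andP; split.
    apply/forallP => i; rewrite ffunE; case: (boolP (i.1 \in S)) => iS; last by rewrite eqxx.
    apply/andP; split.
      apply: (subsetP sW); rewrite in_setU /nbhd in_setD orbC; case: (boolP (f i \in S)) => //= fS.
      rewrite inE orbF; apply/exists_inP; exists i.1 => //; rewrite /adj; apply/imsetP; by exists i.
    by apply: (subsetP HG); have := h1 i (in_setT _); rewrite inE.
  (* Distinct colours force distinct edges. *)
  apply/forallP => i; apply/forallP => j; apply/implyP => iS; apply/implyP => jS.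
  rewrite !ffunE iS jS; apply/implyP => /eqP e; apply/negPn/negP => ij.
  by have := h3 i j (in_setT _) (in_setT _) ij; rewrite /col e eqxx.
have := subset_leq_card cov; rewrite -(ler_nat F) => /le_trans; apply.
rewrite /few_confined mulr_suml.
apply: le_trans (_ : (\sum_(S : {set 'I_n} | (S != set0) && (#|S| <= k)%N)
  \sum_(W : {set 'I_n} | #|W| == 3 * #|S|) \sum_(h in confined G e0 S W)
      #|[set f in TT | [forall i in setX S [set: 'I_6], f i == h i]]|)%N%:R <= _).
  rewrite ler_nat; apply: leq_trans (leq_card_bigcup _ _) _; apply: leq_sum => S _.
  apply: leq_trans (leq_card_bigcup _ _) _; apply: leq_sum => W _.
  exact: leq_card_bigcup.
rewrite natr_sum; apply: ler_sum => S _; rewrite natr_sum mulr_suml; apply: ler_sum => W _.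
rewrite natr_sum -mulrA mulrCA [leRHS]mulr_natl -[leRHS]sumr_const; apply: ler_sum => h _.
have := card_transversals_spread e0 m0 adm_ge cl Dm (setX S [set: 'I_6]) h.
rewrite cardsX cardsT card_ord mulnC -/TT; move/le_trans; apply.
by rewrite (_ : 2 / m = 4 / (p * N)) // /m; field; rewrite !gt_eqF.
Qed.

Let cardG : #|G|%:R <= 2 * p * N ^+ 2.
Proof.
have := setsG [set: 'I_n]; rewrite dirsum_arcs cardsT card_ord -/N => h.
apply: (@le_trans _ _ #|arcs G|%:R); first by rewrite ler_nat card_arcs_ge.
apply: le_trans (_ : p * N ^+ 2 + gam * p * N ^+ 2 <= _).
  apply: le_trans h; rewrite -sumr_const; apply: ler_sum => a _; by rewrite !inE.
have : 0 < p * N ^+ 2 by rewrite mulr_gt0 // exprn_gt0.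
move: gam1; nra.
Qed.

(** The degrees in [B] add up to at least [(2^-1 + eps) * p * N * #|B|]. Since [B] has at most half
    of the vertices, edges inside [B] account for at most [p * N * #|B| / 2 + gam * p * N ^+ 2], and
    edges in the colours of [R] for at most [24 * mu * p * N ^+ 2]. *)
Lemma fresh_crossing_edge (B : {set 'I_n}) (R : {set {set 'I_n}}) :
  (k < #|B|)%N -> (2 * #|B| <= n)%N -> (#|R| <= 12 * n)%N ->
  exists x w, [/\ x \in B, w \notin B, adj H x w & c [set x; w] \notin [seq c f | f in R]].
Proof.
move=> kB Bn Rn.
pose bad := [set e in H | c e \in [seq c f | f in R]].
have badle : #|bad|%:R <= 12 * mu * p * N ^+ 2.
  apply: le_trans (card_same_colour R col_le) _.
  have -> : 12 * mu * p * N ^+ 2 = (12 * n)%:R * (mu * p * N) by rewrite natrM -/N; ring.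
  by rewrite ler_wpM2r ?ler_nat // !mulr_ge0 // ?(ltW p0) ?(ltW N0) ?(ltW mu0).
have [/existsP[x /existsP[w /and4P[xB wB xw cw]]]|no] :=
    boolP [exists x, exists w, [&& x \in B, w \notin B, adj H x w & c [set x; w] \notin [seq c f | f in R]]].
  by exists x, w.
exfalso.
have cr : \sum_(x in B) outdeg F H x <= dirsum G (fun x w => ((x \in B) && (w \in B))%:R) + 2 * #|bad|%:R.
  apply: (@le_trans _ _ (\sum_(x in B) (\sum_(w | adj G x w) ((x \in B) && (w \in B))%:R + outdeg F bad x))).
    apply: ler_sum => x xB; rewrite /outdeg (bigID (mem B)) /=; apply: lerD.
      rewrite [leRHS](bigID (fun w => adj H x w && (w \in B))) /=.
      rewrite [leLHS](_ : _ = \sum_(w | adj G x w && (adj H x w && (w \in B))) ((x \in B) && (w \in B))%:R).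
        by rewrite lerDl sumr_ge0.
      apply: eq_big => w; first by case: (boolP (adj H x w)); rewrite ?andbF //= => /(subsetP HG); rewrite /adj => ->.
      by rewrite xB => /andP[_ ->].
    rewrite [leRHS](bigID (fun w => adj H x w && (w \notin B))) /=.
    rewrite [leLHS](_ : _ = \sum_(w | adj bad x w && (adj H x w && (w \notin B))) 1).
      by rewrite lerDl sumr_ge0.
    apply: eq_bigl => w; apply/idP/andP => [/andP[xw wB]|[_ //]]; split; last by rewrite xw.
    rewrite /adj inE; apply/andP; split => //.
    move/existsPn: no => /(_ x)/existsPn/(_ w); by rewrite xB wB xw /= negbK.
  rewrite big_split /=; apply: lerD.
    rewrite /dirsum [leRHS](bigID (mem B)) /= lerDl.
    by apply: sumr_ge0 => x _; apply: sumr_ge0.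
  apply: le_trans (sum_outdeg_le F bad); rewrite [leRHS](bigID (mem B)) /= lerDl.
  by apply: sumr_ge0 => x _; apply: sumr_ge0.
have lo : (2^-1 + eps) * p * N * #|B|%:R <= \sum_(x in B) outdeg F H x.
  by rewrite mulr_natr -sumr_const; apply: ler_sum => x _; apply: degH.
have s3 := setsG B; rewrite -/N in s3.
have sB : sig * N <= #|B|%:R by apply: le_trans ksig _; rewrite ler_nat.
have Bn' : 2 * #|B|%:R <= N :> F by rewrite -natrM ler_nat.
have pB : p * #|B|%:R ^+ 2 <= p * N * #|B|%:R / 2.
  have : 0 <= p * #|B|%:R by rewrite mulr_ge0 // ltW.
  move: Bn'; set b := #|B|%:R; nra.
have eB : eps * p * N * (sig * N) <= eps * p * N * #|B|%:R.
  by rewrite ler_wpM2l // !mulr_ge0 // ?(ltW eps0) ?(ltW p0) ?(ltW N0).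
have fin : eps * sig * (p * N ^+ 2) <= (gam + 24 * mu) * (p * N ^+ 2).
  move: cr lo s3 pB eB badle; set b := #|B|%:R; set d1 := dirsum _ _; set s1 := \sum_(_ in _) _; set bb := #|bad|%:R.
  lra.
have : 0 < p * N ^+ 2 by rewrite mulr_gt0 // exprn_gt0.
by move=> h; move: fin; rewrite ler_pM2r // leNgt small2.
Qed.

(** Two booster edges of fresh colours close a longest path to a cycle. A cycle that is not
    Hamiltonian is left by some edge, and opening it there gives a path with one more vertex. So at
    most three edges are added. *)
Lemma rainbow_extension (R : {set {set 'I_n}}) : R \subset H -> rainbow R c ->
  (#|R| + 2 <= 12 * n)%N -> expander k R ->
  exists R' : {set {set 'I_n}}, [/\ R \subset R', R' \subset H, rainbow R' c, (#|R'| <= #|R| + 3)%N &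
    (exists2 F', hamilton_cycle H F' & F' \subset R') \/
    (exists2 s, is_path R' s & (size (longest R) < size s)%N)].
Proof.
move=> RH rR Rn ex.
have RG := subset_trans RH HG; have RP := subset_trans RG GP.
have Rn' : (#|R| <= 12 * n)%N by apply: leq_trans Rn; apply: leq_addr.
pose H1 := [set e in H | c e \notin [seq c f | f in R]].
have H1H : H1 \subset H by apply/subsetP => e; rewrite inE => /andP[].
have lost1 : #|H :\: H1|%:R <= 12 * mu * p * N ^+ 2.
  have -> : H :\: H1 = [set e in H | c e \in [seq c f | f in R]].
    by apply/setP => e; rewrite !inE; case: (e \in H); rewrite /= ?andbT ?andbF ?negbK.
  apply: le_trans (card_same_colour R col_le) _.
  have -> : 12 * mu * p * N ^+ 2 = (12 * n)%:R * (mu * p * N) by rewrite natrM -/N; ring.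
  by rewrite ler_wpM2r ?ler_nat // !mulr_ge0 // ?(ltW p0) ?(ltW N0) ?(ltW mu0).
have qbig x y : linked R x y -> sig * N <= #|[set z | linked R x z]|%:R.
  by move=> xy; apply: le_trans ksig _; rewrite ler_nat; apply: card_linked xy.
have n0 : (0 < n)%N by apply: leq_trans n3.
(* At least [sig * N] vertices are linked to one [x], and each of them is linked to at least
   [sig * N] vertices. *)
have Qbig : sig ^+ 2 * N ^+ 2 <= \sum_x #|[set z | linked R x z]|%:R.
  have [x [y xy]] := linked_exists R n0.
  apply: (@le_trans _ _ (\sum_(z in [set z | linked R x z]) #|[set w | linked R z w]|%:R)); last first.
    by rewrite [leRHS](bigID (mem [set z | linked R x z])) /= lerDl sumr_ge0.
  apply: (@le_trans _ _ (\sum_(z in [set z | linked R x z]) sig * N)); last first.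
    by apply: ler_sum => z; rewrite inE linkedC => /qbig.
  rewrite sumr_const -mulr_natl.
  have -> : sig ^+ 2 * N ^+ 2 = sig * N * (sig * N) by ring.
  by rewrite ler_wpM2r ?(qbig _ _ xy) // mulr_ge0 // ltW.
have H1R (R1 : {set {set 'I_n}}) : R1 \subset H1 -> [disjoint R & R1].
  move=> /subsetP R1H; rewrite disjoint_subset; apply/subsetP => e eR; apply/negP => /R1H.
  by rewrite inE => /andP[_ /negP[]]; apply/imageP; exists e.
have HP2 (R1 : {set {set 'I_n}}) : R1 \subset H1 -> (#|R1| <= D1 * n)%N -> _ :=
  fun h1 h2 => missesG RG (subset_trans h1 (subset_trans H1H HG)) (H1R _ h1) Rn' h2.
have [x [y [w [xy xw yv cne]]]] := booster_exists HG H1H n0 p0 gam0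
  (ltW mu0) eps0 degH lost1 col_le cardG (fansG RG Rn') HP2 Qbig D1_ge small1.
have := linkP xy; rewrite /before in yv cne; set t := link R x y in yv cne *; move=> st.
have /and3P[pt /eqP vs /eqP lt] := st; have szt := spans_longest st.
have [xwH cxw] : [set x; w] \in H /\ c [set x; w] \notin [seq c f | f in R].
  by move: xw; rewrite /adj inE => /andP[].
set v := prev _ _ in yv cne.
have [yvH cyv] : [set y; v] \in H /\ c [set y; v] \notin [seq c f | f in R].
  by move: yv; rewrite /adj inE => /andP[].
have cardU (e : {set 'I_n}) (B : {set {set 'I_n}}) : (#|e |: B| <= #|B|.+1)%N.
  by rewrite cardsU1 -add1n leq_add2r leq_b1.
(* If [w] is off the path, [before] is a mere default value there, but the edge [xw] alone lengthens
   the path. *)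
have [wt|wt] := boolP (w \in x :: t); last first.
  exists ([set x; w] |: R); split.
  - exact: subsetUr.
  - by rewrite subUset sub1set xwH.
  - exact: rainbow_setU1.
  - by apply: leq_trans (cardU _ _) _; rewrite addn3 ltnS -addn2 leq_addr.
  - right; exists (w :: x :: t); last by rewrite /= -szt.
    have /andP[u s'] := is_pathS (subsetUr [set [set x; w]] R) pt.
    rewrite /is_path cons_uniq wt u /=.
    by move: s'; rewrite /= => ->; rewrite adjC /adj setU11.
pose R2 := [set x; w] |: ([set y; v] |: R).
have RR2 : R \subset R2 by apply: subset_trans (subsetUr _ _) (subsetUr _ _).
have R2H : R2 \subset H by rewrite !subUset !sub1set xwH yvH.
have rR2 : rainbow R2 c.
  apply: rainbow_setU1; first exact: rainbow_setU1.
  apply/negP => /imageP[f]; rewrite inE => /orP[]; first by rewrite inE => /eqP-> e; rewrite e eqxx in cne.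
  by move=> fR e; case/negP: cxw; rewrite e; apply/imageP; exists f.
have cR2 : (#|R2| <= #|R| + 2)%N.
  apply: leq_trans (cardU _ _) _; rewrite addn2 ltnS; exact: cardU.
have R2P : R2 \subset pairs n := subset_trans R2H (subset_trans HG GP).
have [s [us sv cs]] : exists s, [/\ uniq s, s =i x :: t & cycle (adj R2) s].
  apply: (close_cycle R2P (is_pathS RR2 pt) lt wt); first by rewrite /adj setU11.
  by rewrite /adj !inE eqxx orbT.
have szs : size s = size (longest R).
  by rewrite -szt; apply/perm_size; apply: uniq_perm => //; case/andP: pt.
pose V0 := [set z in s].
have [V0n|] := boolP (~: V0 == set0).
  have all z : z \in s.
    by have := in_setC z V0; rewrite (eqP V0n) !inE => /esym/negbFE.
  have [hc hs] := hamilton_cycle_edges n3 R2H us all cs.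
  exists R2; split => //; first by apply: leq_trans cR2 _; rewrite leq_add2l.
  by left; exists (cycle_edges s).
move=> V0n.
(* An edge leaving the cycle may lie in [R] already, when it adds no colour, or must have a fresh
   colour. A complement of at most [k] vertices yields the former by expansion; otherwise the
   smaller side of the cut yields the latter. *)
have [u [z [uV zV uzH uz]]] : exists u z, [/\ u \in V0, z \notin V0, adj H u z &
   ([set u; z] \in R) || (c [set u; z] \notin [seq c f | f in R2])].
  have kV0 : (k < #|V0|)%N.
    apply: leq_trans (card_linked RP ex xy) _; apply/subset_leq_card/subsetP => z.
    rewrite inE => /asboolP[t' /and3P[_ /eqP vs' /eqP lt']].
    rewrite inE sv -[_ \in _](in_set (mem (x :: t))) /= vs -vs' inE -lt'.
    exact: mem_last.
  have [kV|kV] := leqP #|~: V0| k.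
    have : (0 < #|nbhd R (~: V0)|)%N by apply: leq_ltn_trans (ex _ V0n kV).
    rewrite card_gt0 => /set0Pn[u]; rewrite in_setD inE negbK => /andP[uV].
    rewrite inE => /exists_inP[z]; rewrite inE => zV zu.
    exists u, z; split => //; first by rewrite adjC; apply: (subsetP RH).
    by rewrite [_ \in R]adjC [adj _ _ _]zu.
  have R2n : (#|R2| <= 12 * n)%N by apply: leq_trans cR2 Rn.
  have cV : (#|V0| + #|~: V0| = n)%N by rewrite cardsC card_ord.
  have [le|le] := leqP (2 * #|V0|) n.
    have [u [z [h1 h2 h3 h4]]] := fresh_crossing_edge kV0 le R2n.
    by exists u, z; rewrite h4 orbT.
  have le' : (2 * #|~: V0| <= n)%N by move: cV le; clear; lia.
  have [z [u [h1 h2 h3 h4]]] := fresh_crossing_edge kV le' R2n.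
  rewrite inE in h1; rewrite inE negbK in h2.
  by exists u, z; rewrite adjC h3 setUC h4 orbT.
pose R3 := [set u; z] |: R2.
exists R3; split.
- by apply: subset_trans RR2 (subsetUr _ _).
- by rewrite subUset sub1set R2H andbT; exact: uzH.
- case/orP: uz => uz; last exact: rainbow_setU1.
  by apply: rainbowS rR2; rewrite subUset sub1set subxx (subsetP RR2).
- by apply: leq_trans (cardU _ _) _; rewrite addn3 ltnS -addn2.
- right; rewrite inE in uV; rewrite inE in zV.
  have cs3 : cycle (adj R3) s.
    by apply: sub_cycle cs => a b; apply: (subsetP (subsetUr _ _)).
  have [|s' ps' ss'] := open_cycle us cs3 uV zV; first by rewrite /adj setU11.
  by exists s' => //; rewrite ss' szs.
Qed.

Lemma rainbow_hamilton_cycle : exists2 F', hamilton_cycle H F' & rainbow F' c.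
Proof.
have [R0 [RH rR Rn ex]] := rainbow_expander_exists.
(* Here [m] bounds the remaining rounds. Starting with [6 * n] edges and [m = n.+1], three edges per
   round give the budget [9 * n + 3], so the graph stays below the cap [12 * n]. *)
suff it m (R : {set {set 'I_n}}) : R \subset H -> rainbow R c -> expander k R ->
    (#|R| + 3 * m <= 9 * n + 3)%N -> (n < size (longest R) + m)%N ->
    exists2 F', hamilton_cycle H F' & rainbow F' c.
  by apply: (it n.+1 R0) => //; move: Rn n3; clear; lia.
elim: m R {R0 RH rR Rn ex} => [|m IH] R RH rR ex Rm lm.
  have [/andP[ul _] _] := longestP R.
  by move: lm; rewrite addn0 -[X in (X < _)%N]card_ord -(card_uniqP ul) ltnNge max_card.
have [|R' [RR' RH' rR' cR' [[F' hF sF]|[s ps ls]]]] := rainbow_extension RH rR _ ex; first by move: Rm n3; clear; lia.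
  by exists F' => //; apply: rainbowS rR'.
apply: (IH R') => //; [exact: expanderS ex|by move: cR' Rm; clear; lia|].
have := (longestP R').2 s ps; move: ls lm; clear; lia.
Qed.

End Deterministic.

(** * The binomial random graph *)

Section ExpBounds.
Variable R : realType.
Implicit Type x : R.

Lemma expR_le2 x : x <= 2^-1 -> expR x <= 2.
Proof.
move=> x1; have h := expR_ge1Dx (- x); rewrite expRN in h.
have e0 := expR_gt0 x; rewrite -[expR x]invrK -[2]invrK lef_pV2 ?posrE ?invr_gt0 //.
lra.
Qed.

(** Since [1 - x <= expR (- x)], it suffices that [(1 + x + 2 * x ^+ 2) * (1 - x) = 1 + x ^+ 2 * (1
    - 2 * x)] is at least 1. *)
Lemma expR_le_quadratic x : x <= 2^-1 -> expR x <= 1 + x + 2 * x ^+ 2.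
Proof.
move=> x1; have h := expR_ge1Dx (- x); rewrite expRN in h.
have e0 := expR_gt0 x.
have : expR x * (1 - x) <= 1.
  by have := ler_wpM2l (ltW e0) h; rewrite mulfV // gt_eqF.
have : 1 <= (1 + x + 2 * x ^+ 2) * (1 - x).
  have : 0 <= x ^+ 2 * (1 - 2 * x) by rewrite mulr_ge0 ?sqr_ge0 // subr_ge0; lra.
  nra.
move=> /[swap] /le_trans /[apply]; rewrite ler_pM2r //; lra.
Qed.

End ExpBounds.

(** * Expectations, union bounds and exponential moments in the binomial random graph *)

Section Gnp.
Variables (R : realType) (n : nat) (p : R).
Hypothesis p01 : 0 <= p <= 1.
Local Notation graph := {set {set 'I_n}}.

Definition gnp_weight (G : graph) : R := p ^+ #|G| * (1 - p) ^+ #|pairs n :\: G|.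

Definition gnp_mean (f : graph -> R) : R :=
  \sum_(G : graph | G \subset pairs n) gnp_weight G * f G.

Let p0 : 0 <= p. Proof. by case/andP: p01. Qed.
Let q0 : 0 <= 1 - p. Proof. by case/andP: p01 => _; rewrite subr_ge0. Qed.

Lemma gnp_weight_ge0 G : 0 <= gnp_weight G.
Proof. by rewrite mulr_ge0 // exprn_ge0. Qed.

Lemma gnp_probE (A : graph -> Prop) : gnp_prob p A = gnp_mean (fun G => `[< A G >]%:R).
Proof.
rewrite /gnp_prob /gnp_mean big_mkcondr /=; apply: eq_bigr => G _.
by case: `[< _ >]; rewrite ?mulr1 ?mulr0.
Qed.

Lemma ler_gnp_mean (f g : graph -> R) : (forall G : graph, G \subset pairs n -> f G <= g G) -> gnp_mean f <= gnp_mean g.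
Proof. by move=> fg; apply: ler_sum => G GP; rewrite ler_wpM2l ?gnp_weight_ge0 ?fg. Qed.

Lemma gnp_meanZ k (f : graph -> R) : gnp_mean (fun G => k * f G) = k * gnp_mean f.
Proof. by rewrite /gnp_mean mulr_sumr; apply: eq_bigr => G _; rewrite mulrCA. Qed.

Lemma gnp_mean_sum (I : finType) (P : pred I) (f : I -> graph -> R) :
  gnp_mean (fun G => \sum_(i | P i) f i G) = \sum_(i | P i) gnp_mean (f i).
Proof.
by rewrite /gnp_mean exchange_big /=; apply: eq_bigr => G _; rewrite mulr_sumr.
Qed.

(** Independence of the edges: expanding the right-hand product, each pair contributes its first
    term if it is an edge of [G] and its second term otherwise. *)
Lemma gnp_mean_prod (x : {set 'I_n} -> R) (R0 : graph) : R0 \subset pairs n ->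
  gnp_mean (fun G => (R0 \subset G)%:R * \prod_(e in G) x e) =
  \prod_(e in pairs n) (p * x e + (1 - p) * (e \notin R0)%:R).
Proof.
move=> R0P; rewrite big_mkcond /=.
(* Sets that are not pairs get the terms 0 and 1, which removes all [G] that are not graphs from the
   expansion. *)
rewrite (eq_bigr (fun e => (if e \in pairs n then p * x e else 0) +
    (if e \in pairs n then (1 - p) * (e \notin R0)%:R else 1))); last first.
  by move=> e _; case: ifP => // _; rewrite add0r.
rewrite bigA_distr /gnp_mean big_mkcond /=; apply: eq_bigr => G _.
case: ifP => [GP|/negbT/subsetPn[e eG eP]]; last first.
  by rewrite (bigD1 e) //= eG (negbTE eP) mul0r.
rewrite [RHS](bigID (mem G)) /=.
rewrite [X in _ = X * _](eq_bigr (fun e => p * x e)); last by move=> e eG; rewrite eG (subsetP GP).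
rewrite big_split /= prodr_const.
rewrite [X in _ = _ * X](bigID (mem (pairs n))) /=.
rewrite [X in _ = _ * (_ * X)]big1 ?mulr1; last first.
  by move=> e /andP[/negbTE -> /negbTE ->].
rewrite [X in _ = _ * X](eq_bigr (fun e => (1 - p) * (e \notin R0)%:R)); last first.
  by move=> e /andP[/negbTE -> ->].
rewrite big_split /= prodr_const.
have cE : #|pairs n :\: G| = #|[pred e | (e \notin G) && (e \in pairs n)]|.
  by apply: eq_card => e; rewrite in_setD.
rewrite /gnp_weight cE.
have -> : \prod_(e | (e \notin G) && (e \in pairs n)) (e \notin R0)%:R = (R0 \subset G)%:R :> R.
  have [RG|/subsetPn[e eR eG]] := boolP (R0 \subset G).
    by rewrite big1 // => e /andP[eG _]; rewrite (contra (subsetP RG e) eG).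
  by rewrite (bigD1 e) /= ?eR ?mul0r // eG (subsetP R0P).
by rewrite [_%:R * _]mulrC mulrACA.
Qed.

Lemma gnp_mean1 : gnp_mean (fun=> 1) = 1.
Proof.
have := gnp_mean_prod (fun=> 1) (sub0set (pairs n)).
rewrite [RHS]big1 => [h|e _]; last by rewrite inE /=; ring.
rewrite -[RHS]h.
by rewrite /gnp_mean; apply: eq_bigr => G _; rewrite sub0set mul1r big1.
Qed.

(** Only an inequality, as [T] may contain sets that are not pairs; the probability is then 0. *)
Lemma gnp_prob_subset (T : graph) : gnp_prob p (fun G => T \subset G) <= p ^+ #|T|.
Proof.
rewrite gnp_probE; have [TP|TP] := boolP (T \subset pairs n); last first.
  rewrite /gnp_mean big1 ?exprn_ge0 // => G GP.
  have /negP/negbTE : ~ T \subset G by move=> /subset_trans/(_ GP); apply/negP.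
  by move=> ->; rewrite asboolF // mulr0.
have := gnp_mean_prod (fun=> 1) TP.
have -> : gnp_mean (fun G => (T \subset G)%:R * \prod_(e in G) 1) = gnp_mean (fun G => `[< T \subset G >]%:R).
  by apply: eq_bigr => G _; rewrite big1 // mulr1 asboolb.
move=> ->; rewrite (bigID (mem T)) /= [X in _ * X]big1 ?mulr1; last first.
  by move=> e /andP[_ ->] /=; ring.
rewrite -prodr_const [leLHS](eq_bigl (mem T)) => [|e]; last by apply/andP/idP => [[_ //]|eT]; split => //; exact: (subsetP TP).
by rewrite le_eqVlt; apply/orP; left; apply/eqP/eq_bigr => e eT; rewrite (eT : e \in T) /=; ring.
Qed.

Lemma gnp_prob_le1 (A : graph -> Prop) : gnp_prob p A <= 1.
Proof.
rewrite gnp_probE -[leRHS]gnp_mean1.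
apply: (@ler_gnp_mean _ (fun=> 1)) => G _; by case: `[< _ >].
Qed.

Lemma ler_gnp_prob (A B : graph -> Prop) : (forall G : graph, G \subset pairs n -> A G -> B G) ->
  gnp_prob p A <= gnp_prob p B.
Proof.
move=> AB; rewrite !gnp_probE; apply: ler_gnp_mean => G GP; rewrite ler_nat.
by case: (asboolP (A G)) => // /(AB _ GP) h; case: asboolP.
Qed.

Lemma gnp_prob_or (A B : graph -> Prop) :
  gnp_prob p (fun G => A G \/ B G) <= gnp_prob p A + gnp_prob p B.
Proof.
rewrite !gnp_probE /gnp_mean -big_split /=; apply: ler_sum => G _.
rewrite -mulrDr ler_wpM2l ?gnp_weight_ge0 // -natrD ler_nat.
by case: (asboolP (_ \/ _)) => //; do 2![case: asboolP] => //; tauto.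
Qed.

Lemma gnp_prob_not (A : graph -> Prop) : gnp_prob p A = 1 - gnp_prob p (fun G => ~ A G).
Proof.
apply/eqP; rewrite eq_sym subr_eq !gnp_probE -[X in X == _]gnp_mean1 /gnp_mean -big_split /=; apply/eqP.
apply: eq_bigr => G _; rewrite -mulrDr; congr (_ * _).
by case: (asboolP (A G)); case: asboolP => //=; rewrite ?addr0 ?add0r.
Qed.

Lemma gnp_prob_exists (I : finType) (P : pred I) (A : I -> graph -> Prop) :
  gnp_prob p (fun G => exists2 i, P i & A i G) <= \sum_(i | P i) gnp_prob p (A i).
Proof.
rewrite gnp_probE (eq_bigr (fun i => gnp_mean (fun G => `[< A i G >]%:R))); last first.
  by move=> i _; rewrite gnp_probE.
rewrite -gnp_mean_sum; apply: ler_gnp_mean => G _.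
case: asboolP => [[i Pi AiG]|_]; last by apply: sumr_ge0.
by rewrite (bigD1 i) //= asboolT // lerDl sumr_ge0.
Qed.

Lemma gnp_markov (f : graph -> R) (A : graph -> Prop) : (forall G, 0 <= f G) ->
  (forall G : graph, G \subset pairs n -> A G -> 1 <= f G) -> gnp_prob p A <= gnp_mean f.
Proof.
move=> f0 Af; rewrite gnp_probE; apply: ler_gnp_mean => G GP.
by case: (asboolP (A G)) => // /(Af _ GP).
Qed.

(* Keeping the event [R0 \subset G] inside the exponential moment gives the factor
   that makes a union bound over [R0] affordable. *)
Lemma gnp_tail (R0 : graph) (u : {set 'I_n} -> R) (lam tau V : R) : R0 \subset pairs n ->
  0 <= lam -> (forall e, `|lam * u e| <= 2^-1) -> \sum_(e in pairs n) u e ^+ 2 <= V ->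
  gnp_prob p (fun G => R0 \subset G /\ p * (\sum_(e in pairs n) u e) + tau < \sum_(e in G) u e)
    <= (4 * p) ^+ #|R0| * expR (2 * p * lam ^+ 2 * V - lam * tau).
Proof.
move=> R0P lam0 ub uV.
set m := \sum_(e in pairs n) u e.
apply: (@le_trans _ _ (gnp_mean (fun G => expR (- lam * (p * m + tau)) *
    ((R0 \subset G)%:R * \prod_(e in G) expR (lam * u e))))).
  apply: gnp_markov => [G|G GP [RG lt]].
    by rewrite mulr_ge0 ?expR_ge0 // mulr_ge0 // prodr_ge0 // => e _; apply: expR_ge0.
  rewrite RG mul1r -expR_sum -expRD -expR0 ler_expR -mulr_sumr.
  by rewrite mulNr addrC subr_ge0 ler_wpM2l // ltW.
rewrite gnp_meanZ gnp_mean_prod //.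
pose b e := lam * u e + 2 * (lam * u e) ^+ 2.
(* This keeps [expR (p * b e)] above one half, so that an edge of [R0], with factor at most [2 * p],
   can be charged [4 * p] times the exponential common to all edges. *)
have b0 e : - 8^-1 <= b e by rewrite /b; set x := lam * u e; have := sqr_ge0 (x + 4^-1); nra.
have fac : \prod_(e in pairs n) (p * expR (lam * u e) + (1 - p) * (e \notin R0)%:R) <=
    \prod_(e in pairs n) ((if e \in R0 then 4 * p else 1) * expR (p * b e)).
  apply: ler_prod => e _; apply/andP; split.
    by rewrite addr_ge0 // mulr_ge0 // expR_ge0.
  have le2 : lam * u e <= 2^-1 by apply: le_trans (ler_norm _) (ub e).
  have lo := expR_ge1Dx (p * b e).
  case: ifP => _ /=.
    rewrite mulr0 addr0 mulrC.
    apply: (@le_trans _ _ (2 * p)); first by rewrite ler_wpM2r // expR_le2.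
    have : 2^-1 <= expR (p * b e).
      apply: le_trans lo; have := b0 e; have /andP[_ p1] := p01.
      have : p * (- 8^-1) <= p * b e by rewrite ler_wpM2l.
      lra.
    by move=> h; have := ler_wpM2l p0 h; lra.
  rewrite mulr1 mul1r; apply: le_trans lo.
  have := ler_wpM2l p0 (expR_le_quadratic le2); rewrite /b; lra.
apply: le_trans (ler_wpM2l (expR_ge0 _) fac) _.
rewrite big_split /= -big_mkcondr /= (eq_bigl (mem R0)); last first.
  by move=> e; apply/andP/idP => [[_ //]|eR]; split => //; exact: (subsetP R0P).
rewrite prodr_const mulrCA -expR_sum -expRD ler_wpM2l ?exprn_ge0 ?mulr_ge0 //.
rewrite ler_expR -mulr_sumr big_split /= -mulr_sumr -/m.
have -> : \sum_(i in pairs n) 2 * (lam * u i) ^+ 2 = 2 * lam ^+ 2 * \sum_(e in pairs n) u e ^+ 2.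
  by rewrite mulr_sumr; apply: eq_bigr => e _; rewrite exprMn mulrA.
have : 2 * p * lam ^+ 2 * \sum_(e in pairs n) u e ^+ 2 <= 2 * p * lam ^+ 2 * V.
  by rewrite ler_wpM2l // !mulr_ge0 // sqr_ge0.
set v := \sum_(e in _) _; lra.
Qed.

(** Replacing [a] by [a * th] costs at most [th^-1 ^+ k], and the sum over all graphs is then
    [(1 + a * th) ^+ #|pairs n|]. A small [th] makes the exponential a small power of the tail
    bound. *)
Lemma sum_expr_card_le (a th : R) (k : nat) : 0 <= a -> 0 < th <= 1 ->
  \sum_(R0 : graph | (R0 \subset pairs n) && (#|R0| <= k)%N) a ^+ #|R0|
    <= th^-1 ^+ k * expR (a * th * #|pairs n|%:R).
Proof.
move=> a0 /andP[th0 th1]; have at0 : 0 <= a * th by rewrite mulr_ge0 // ltW.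
apply: (@le_trans _ _ (th^-1 ^+ k * \sum_(R0 : graph | R0 \subset pairs n) (a * th) ^+ #|R0|)).
  rewrite mulr_sumr big_mkcondr /=; apply: ler_sum => R0 _; case: ifP => [Rk|_]; last first.
    by rewrite mulr_ge0 ?exprn_ge0 // invr_ge0 ltW.
  have -> : a ^+ #|R0| = th^-1 ^+ #|R0| * (a * th) ^+ #|R0|.
    by rewrite -exprMn mulrCA mulVf ?mulr1 // gt_eqF.
  rewrite ler_wpM2r ?exprn_ge0 // ler_weXn2l //.
  by rewrite invf_ge1.
rewrite ler_wpM2l ?exprn_ge0 ?invr_ge0 ?(ltW th0) //.
have -> : \sum_(R0 : graph | R0 \subset pairs n) (a * th) ^+ #|R0| = \prod_(e in pairs n) (a * th + 1).
  rewrite [RHS]big_mkcond /= (eq_bigr (fun e => (if e \in pairs n then a * th else 0) + 1)); last first.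
    by move=> e _; case: ifP; rewrite ?add0r.
  rewrite bigA_distr big_mkcond /=; apply: eq_bigr => G _.
  case: ifP => [GP|/negbT/subsetPn[e eG eP]]; last first.
    by rewrite (bigD1 e) //= eG (negbTE eP) mul0r.
  rewrite -big_mkcond -prodr_const; apply: eq_bigr => e eG; by rewrite (subsetP GP).
rewrite prodr_const expRM_natr.
rewrite lerXn2r ?nnegrE ?expR_ge0 ?addr_ge0 //.
by rewrite addrC expR_ge1Dx.
Qed.

End Gnp.

(** * Good graphs are typical *)

Section Regularity.
Variables (R : realType) (n : nat) (p : R).
Hypothesis p01 : 0 <= p <= 1.
Local Notation graph := {set {set 'I_n}}.
Let N : R := n%:R.
Let p0 : 0 <= p. Proof. by case/andP: p01. Qed.

(** The two orientations of an edge are not independent, so their weights are merged before the tail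
    bound is applied. *)
Definition edge_weight (u : 'I_n -> 'I_n -> R) (e : {set 'I_n}) : R :=
  \sum_(a : 'I_n * 'I_n | [set a.1; a.2] == e) u a.1 a.2.

Lemma dirsumE (G : graph) u : dirsum G u = \sum_(e in G) edge_weight u e.
Proof.
rewrite dirsum_arcs (partition_big (fun a : 'I_n * 'I_n => [set a.1; a.2]) (mem G)) /=.
  apply: eq_bigr => e eG; apply: eq_bigl => a; rewrite inE.
  by rewrite /adj; apply/andP/idP => [[_ //]|/eqP ->]; rewrite eG.
by move=> a; rewrite inE.
Qed.

Lemma edge_weight_bound u e : (forall x w, 0 <= u x w <= 1) -> 0 <= edge_weight u e <= 2.
Proof.
move=> u01; apply/andP; split; first by apply: sumr_ge0 => a _; case/andP: (u01 a.1 a.2).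
pose D := [set a : 'I_n * 'I_n | [set a.1; a.2] == e].
apply: (@le_trans _ _ #|D|%:R).
  rewrite -sumr_const /edge_weight (eq_bigl (fun a => a \in D)); last by move=> a; rewrite inE.
  by apply: ler_sum => a _; case/andP: (u01 a.1 a.2).
rewrite ler_nat; apply: leq_trans (card_ordered_edges D) _.
rewrite -[leqRHS]muln1 leq_mul2l /= -(cards1 e); apply/subset_leq_card/subsetP => f /imsetP[a + ->].
by rewrite !inE.
Qed.

Lemma card_pairs_le : (#|pairs n| <= n ^ 2)%N.
Proof.
apply: leq_trans (card_arcs_ge (subxx (pairs n))) _.
by apply: leq_trans (max_card _) _; rewrite card_prod card_ord.
Qed.

(** This is [gnp_tail] with [V = 4 * N ^+ 2] and [lam = gam / 16], the minimiser of the exponent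
    [(8 * lam ^+ 2 - lam * gam) * p * N ^+ 2]. *)
Lemma dirsum_tail (R0 : graph) (u : 'I_n -> 'I_n -> R) (gam m : R) : R0 \subset pairs n ->
  0 < gam <= 1 -> (forall x w, 0 <= u x w <= 1) -> \sum_x \sum_w u x w <= m ->
  gnp_prob p (fun G : graph => R0 \subset G /\ p * m + gam * p * N ^+ 2 < dirsum G u)
    <= (4 * p) ^+ #|R0| * expR (- (gam ^+ 2 / 32 * p * N ^+ 2)).
Proof.
move=> R0P /andP[g0 g1] u01 um.
have eb e := edge_weight_bound e u01.
have g16 : 0 <= gam / 16 by rewrite divr_ge0 // ltW.
have sm : \sum_(e in pairs n) edge_weight u e <= m.
  apply: le_trans um; rewrite -dirsumE /dirsum; apply: ler_sum => x _.
  rewrite [leRHS](bigID (adj (pairs n) x)) /= lerDl.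
  by apply: sumr_ge0 => w _; case/andP: (u01 x w).
have V : \sum_(e in pairs n) edge_weight u e ^+ 2 <= 4 * N ^+ 2.
  apply: (@le_trans _ _ (\sum_(e in pairs n) 4)).
    apply: ler_sum => e _; have /andP[h1 h2] := eb e.
    have -> : 4 = 2 ^+ 2 :> R by rewrite -natrX.
    by rewrite lerXn2r ?nnegrE.
  rewrite sumr_const -[leLHS]mulr_natr ler_wpM2l // -natrX ler_nat; exact: card_pairs_le.
have small e : `|gam / 16 * edge_weight u e| <= 2^-1.
  have /andP[h1 h2] := eb e; rewrite ger0_norm ?(mulr_ge0 g16 h1) //.
  have : gam / 16 * edge_weight u e <= gam / 16 * 2 by rewrite ler_wpM2l.
  lra.
apply: le_trans (ler_gnp_prob p01 _) (le_trans (gnp_tail p01 (gam * p * N ^+ 2) R0P g16 small V) _).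
  move=> G _ [RG h]; split => //; rewrite dirsumE in h; apply: le_lt_trans h.
  by rewrite lerD2r ler_wpM2l.
rewrite ler_wpM2l ?exprn_ge0 ?mulr_ge0 // ler_expR le_eqVlt; apply/orP; left; apply/eqP.
by field.
Qed.

Definition tail gam : R := expR (- (gam ^+ 2 / 32 * p * N ^+ 2)).

Lemma dirsum_tail_family (I : finType) (P : pred I) (R0 : I -> graph)
    (u : I -> 'I_n -> 'I_n -> R) (m : I -> R) (gam : R) :
  0 < gam <= 1 ->
  (forall i, P i -> [/\ R0 i \subset pairs n, (forall x w, 0 <= u i x w <= 1) &
     \sum_x \sum_w u i x w <= m i]) ->
  gnp_prob p (fun G : graph => exists2 i, P i & R0 i \subset G /\ p * m i + gam * p * N ^+ 2 < dirsum G (u i))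
    <= \sum_(i | P i) (4 * p) ^+ #|R0 i| * tail gam.
Proof.
move=> g01 H.
apply: le_trans (gnp_prob_exists p01 P
   (fun i (G : graph) => R0 i \subset G /\ p * m i + gam * p * N ^+ 2 < dirsum G (u i))) _.
apply: ler_sum => i Pi; have [h1 h2 h3] := H i Pi.
exact: dirsum_tail.
Qed.

Let indic01 (b : bool) : 0 <= (b%:R : R) <= 1.
Proof. by case: b; rewrite ?lexx ?ler01. Qed.

(** Union bound over [R], over the [N] choices of [y] and the [2 ^+ n] choices of [A]. *)
Lemma prob_not_sparse_fans (gam : R) : 0 < gam <= 1 ->
  gnp_prob p (fun G : graph => ~ sparse_fans G p gam) <=
  (\sum_(R0 : graph | (R0 \subset pairs n) && (#|R0| <= 12 * n)%N) (4 * p) ^+ #|R0|)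
    * (N * 2 ^+ n * tail gam).
Proof.
move=> g01.
pose I := (graph * ('I_n * {set 'I_n}))%type.
pose P (i : I) := (i.1 \subset pairs n) && (#|i.1| <= 12 * n)%N.
pose u (i : I) x w : R := (linked i.1 x i.2.1 && (before i.1 i.2.1 x w \in i.2.2))%:R.
pose m (i : I) : R := #|[set z | linked i.1 i.2.1 z]|%:R * #|i.2.2|%:R.
apply: le_trans (ler_gnp_prob p01 (B := fun G : graph => exists2 i, P i & i.1 \subset G /\
   p * m i + gam * p * N ^+ 2 < dirsum G (u i)) _) _.
  move=> G GP h; apply: contrapT => no; apply: h => R0 R0G R0n y A.
  rewrite leNgt; apply/negP => lt; apply: no; exists (R0, (y, A)).
    by rewrite /P /= R0n andbT; apply: subset_trans GP.
  by split => //=; rewrite /m /= mulrA.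
apply: le_trans (dirsum_tail_family g01 _) _.
  move=> i /andP[iP _]; split => // [x w|]; first exact: indic01.
  rewrite /m; apply: (@le_trans _ _ (\sum_(x in [set z | linked i.1 i.2.1 z]) #|i.2.2|%:R)).
    rewrite [leLHS](bigID (mem [set z | linked i.1 i.2.1 z])) /= [X in _ + X]big1 ?addr0; last first.
      by move=> x; rewrite inE linkedC => /negbTE nl; rewrite big1 // => w _; rewrite /u nl.
    apply: ler_sum => x _; apply: (@le_trans _ _ #|[set w | before i.1 i.2.1 x w \in i.2.2]|%:R).
      rewrite -sumr_const [leRHS]big_mkcond /=; apply: ler_sum => w _; rewrite /u inE.
      by case: (linked _ _ _); case: (_ \in _); rewrite /= ?lexx ?ler01.
    rewrite ler_nat -(card_imset _ (@before_inj _ i.1 i.2.1 x)).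
    by apply/subset_leq_card/subsetP => _ /imsetP[w + ->]; rewrite inE.
  by rewrite sumr_const mulr_natl.
rewrite (eq_bigl (fun i : I => ((i.1 \subset pairs n) && (#|i.1| <= 12 * n)%N) && xpredT i.2)); last first.
  by move=> i; rewrite andbT.
rewrite -(pair_big (fun R0 : graph => (R0 \subset pairs n) && (#|R0| <= 12 * n)%N) xpredT
  (fun R0 _ => (4 * p) ^+ #|R0| * tail gam)) /=.
rewrite mulr_suml; apply: ler_sum => R0 _.
rewrite sumr_const card_prod card_ord -cardsT -powersetT card_powerset cardsT card_ord.
by rewrite -[leLHS]mulr_natl natrM natrX -/N mulrCA.
Qed.

Lemma prob_not_sparse_misses D1 (gam : R) : 0 < gam <= 1 ->
  gnp_prob p (fun G : graph => ~ sparse_misses G p gam D1) <=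
  (\sum_(R0 : graph | (R0 \subset pairs n) && (#|R0| <= 12 * n)%N) (4 * p) ^+ #|R0|)
    * (\sum_(R0 : graph | (R0 \subset pairs n) && (#|R0| <= D1 * n)%N) (4 * p) ^+ #|R0|)
    * tail gam.
Proof.
move=> g01.
pose P (i : graph * graph) := [&& (i.1 \subset pairs n) && (#|i.1| <= 12 * n)%N,
  (i.2 \subset pairs n) && (#|i.2| <= D1 * n)%N & [disjoint i.1 & i.2]].
pose q (R0 : graph) y : R := #|[set z | linked R0 y z]|%:R / N.
pose h (i : graph * graph) y := hit (linked i.1) (before i.1) i.2 y.
pose u (i : graph * graph) y v : R := if v \in h i y then 0 else q i.1 y.
pose m (i : graph * graph) : R := \sum_y q i.1 y * (N - #|h i y|%:R).
apply: le_trans (ler_gnp_prob p01 (B := fun G : graph => exists2 i, P i & i.1 :|: i.2 \subset G /\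
   p * m i + gam * p * N ^+ 2 < dirsum G (u i)) _) _.
  move=> G GP no; apply: contrapT => no'; apply: no => R0 R1 R0G R1G dj R0n R1n.
  rewrite leNgt; apply/negP => lt; apply: no'; exists (R0, R1).
    by rewrite /P /= R0n R1n dj !andbT (subset_trans R0G GP) (subset_trans R1G GP).
  by split => //=; rewrite subUset R0G.
apply: le_trans (dirsum_tail_family g01 _) _.
  move=> i /and3P[/andP[iP _] /andP[iP' _] _]; split; first by rewrite subUset iP.
    move=> y v; rewrite /u; case: ifP => _; first by rewrite lexx ler01.
    rewrite /q divr_ge0 //=; have n0 : (0 < n)%N := leq_ltn_trans (leq0n y) (ltn_ord y).
    by rewrite ler_pdivrMr ?ltr0n // mul1r ler_nat -[leqRHS]card_ord max_card.
  rewrite /m; apply: ler_sum => y _.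
  rewrite (bigID (mem (h i y))) /= [X in X + _]big1 ?add0r; last by move=> v vh; rewrite /u vh.
  rewrite (eq_bigr (fun=> q i.1 y)); last by move=> v /negbTE vh; rewrite /u vh.
  rewrite sumr_const -[leLHS]mulr_natr ler_wpM2l ?divr_ge0 //.
  rewrite lerBrDr -natrD ler_nat.
  apply: leq_trans (_ : #|h i y| + #|~: h i y| <= _)%N; last by rewrite cardsC card_ord.
  rewrite addnC leq_add2l; apply: eq_leq; apply: eq_card => v.
  by rewrite [RHS]inE.
rewrite (eq_bigr (fun i : graph * graph => (4 * p) ^+ #|i.1| * ((4 * p) ^+ #|i.2| * tail gam))); last first.
  move=> i /and3P[_ _ dj]; rewrite cardsU disjoint_setI0 // cards0 subn0 exprD; exact: esym (mulrA _ _ _).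
apply: (@le_trans _ _ (\sum_(i : graph * graph | ((i.1 \subset pairs n) && (#|i.1| <= 12 * n)%N) &&
  ((i.2 \subset pairs n) && (#|i.2| <= D1 * n)%N)) (4 * p) ^+ #|i.1| * ((4 * p) ^+ #|i.2| * tail gam))).
  rewrite big_mkcond [leRHS]big_mkcond /=; apply: ler_sum => i _; rewrite /P.
  have t0 : 0 <= (4 * p) ^+ #|i.1| * ((4 * p) ^+ #|i.2| * tail gam).
    by rewrite !mulr_ge0 ?exprn_ge0 ?mulr_ge0 // expR_ge0.
  rewrite andbA; case: [disjoint i.1 & i.2]; rewrite ?andbT ?andbF //; by case: ifP.
rewrite -(pair_big (fun R0 : graph => (R0 \subset pairs n) && (#|R0| <= 12 * n)%N)
  (fun R0 : graph => (R0 \subset pairs n) && (#|R0| <= D1 * n)%N)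
  (fun R0 R1 : graph => (4 * p) ^+ #|R0| * ((4 * p) ^+ #|R1| * tail gam))) /=.
by rewrite -mulrA mulr_suml; apply: ler_sum => R0 _; rewrite -mulr_sumr -mulr_suml.
Qed.

Lemma prob_not_sparse_sets (gam : R) : 0 < gam <= 1 ->
  gnp_prob p (fun G : graph => ~ sparse_sets G p gam) <= 2 ^+ n * tail gam.
Proof.
move=> g01.
pose u (A : {set 'I_n}) x w : R := ((x \in A) && (w \in A))%:R.
pose m (A : {set 'I_n}) : R := #|A|%:R ^+ 2.
apply: le_trans (ler_gnp_prob p01 (B := fun G : graph => exists2 A : {set 'I_n}, true & set0 \subset G /\
   p * m A + gam * p * N ^+ 2 < dirsum G (u A)) _) _.
  move=> G GP no; apply: contrapT => no'; apply: no => A.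
  by rewrite leNgt; apply/negP => lt; apply: no'; exists A => //; rewrite sub0set.
apply: le_trans (dirsum_tail_family g01 _) _.
  move=> A _; split => [|x w|]; [exact: sub0set|exact: indic01|].
  rewrite /m expr2 -natrM -cardsX -[leRHS](sumr_const (mem (setX A A)) (1 : R)) pair_big /=.
  rewrite [leRHS]big_mkcond /=; apply: ler_sum => -[a b] _.
  by rewrite /u in_setX /=; case: (_ && _).
rewrite (eq_bigr (fun=> tail gam)); last by move=> A _; rewrite cards0 expr0 mul1r.
by rewrite sumr_const -cardsT -powersetT card_powerset cardsT card_ord -[leLHS]mulr_natl natrX.
Qed.

Lemma deg_outdeg (G : graph) v : G \subset pairs n -> (deg G v)%:R = outdeg R G v.
Proof.
move=> GP; rewrite /outdeg sumr_const; congr (_%:R).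
rewrite -(card_imset (mem (fun w => adj G v w)) (f := fun w => [set v; w])).
  rewrite /deg; apply: eq_card => e; rewrite inE; apply/andP/imsetP => [[eG ve]|[w vw ->]].
    have := subsetP GP _ eG; rewrite inE => /cards2P[a [b [_ ee]]].
    move: ve eG; rewrite ee !inE => /orP[]/eqP <- abG; first by exists b.
    exists a; [by rewrite unfold_in /adj setUC|by rewrite setUC].
  by rewrite set21; split.
move=> w w' /set2_eq[[]//|[-> ->]] //.
Qed.

(** The lower tail is the upper tail for the weight -1 on the pairs at [v], with [lam = gam / 4] and
    [V = N]. *)
Lemma prob_low_degree (v : 'I_n) (gam : R) : 0 <= gam <= 1 ->
  gnp_prob p (fun G : graph => outdeg R G v < p * (N - 1) - gam * p * N) <=
    expR (- (gam ^+ 2 / 8 * p * N)).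
Proof.
move=> /andP[g0 g1].
pose u (e : {set 'I_n}) : R := - (v \in e)%:R.
have sumu (G : graph) : G \subset pairs n -> \sum_(e in G) u e = - outdeg R G v.
  move=> GP; rewrite -deg_outdeg // /deg sumrN -sum1_card natr_sum; congr (- _).
  rewrite (bigID (fun e : {set _} => v \in e)) /= [X in _ + X]big1 ?addr0; last by move=> e /andP[_ /negbTE ->].
  by apply: eq_big => e; [rewrite inE|move=> /andP[_ ->]].
have outP : outdeg R (pairs n) v = N - 1.
  rewrite /outdeg sumr_const; apply/eqP; rewrite eq_sym subr_eq natr1.
  have n0 : (0 < n)%N := leq_ltn_trans (leq0n v) (ltn_ord v).
  rewrite -[X in X%:R == _](prednK n0) -[X in X.-1.+1%:R == _]card_ord -(cardsC1 v).
  apply/eqP; congr (_.+1%:R); apply: eq_card => w.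
  transitivity (adj (pairs n) v w) => //.
  by rewrite /adj [RHS]inE cards2 !inE eq_sym; case: (_ == _).
have g4 : 0 <= gam / 4 by rewrite divr_ge0.
have small e : `|gam / 4 * u e| <= 2^-1.
  rewrite /u; case: (v \in e); rewrite ?oppr0 ?mulr0 ?normr0 ?invr_ge0 //.
  by rewrite mulrN1 normrN ger0_norm //; lra.
have V : \sum_(e in pairs n) u e ^+ 2 <= N.
  have -> : \sum_(e in pairs n) u e ^+ 2 = - \sum_(e in pairs n) u e.
    rewrite -sumrN; apply: eq_bigr => e _; rewrite /u.
    by case: (v \in e); rewrite ?oppr0 ?expr0n // sqrrN expr1n opprK.
  by rewrite sumu // opprK outP gerBl.
apply: le_trans (ler_gnp_prob p01 _) (le_trans (gnp_tail p01 (gam * p * N) (sub0set _) g4 small V) _).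
  move=> G GP h; split; first exact: sub0set.
  by rewrite !sumu // outP; lra.
rewrite cards0 expr0 mul1r ler_expR le_eqVlt; apply/orP; left; apply/eqP.
by field.
Qed.

End Regularity.

(** * First moment of the confined choices *)

Section ConfinedMean.
Variable R : realType.

(** One term of the exponential series at [s], together with [expR 1 <= 4]. *)
Lemma expn_le_fact (s : nat) : s%:R ^+ s <= 4 ^+ s * s`!%:R :> R.
Proof.
case: s => [|s]; first by rewrite !expr0 mul1r.
have := @expR_ge1Dxn R s.+1%:R s (ler0n _ _).
have -> : expR s.+1%:R = expR 2^-1 ^+ 2 ^+ s.+1 :> R.
  by rewrite -!expRM_natl; congr expR; field.
have e4 : expR (2^-1 : R) ^+ 2 <= 4.
  have -> : 4 = 2 ^+ 2 :> R by rewrite -natrX.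
  by rewrite lerXn2r ?nnegrE ?expR_ge0 // expR_le2.
have : expR (2^-1 : R) ^+ 2 ^+ s.+1 <= 4 ^+ s.+1.
  by rewrite lerXn2r ?nnegrE ?exprn_ge0 ?expR_ge0.
move=> h1 h2; rewrite -ler_pdivrMr ?ltr0n ?fact_gt0 //.
apply: le_trans h1; apply: le_trans h2; by rewrite lerDr.
Qed.

Lemma bin_le_expn (n s : nat) : (0 < s)%N -> 'C(n, s)%:R <= (4 * n%:R / s%:R) ^+ s :> R.
Proof.
move=> s0; have ss : 0 < s%:R :> R by rewrite ltr0n.
rewrite exprMn exprVn -ler_pdivrMr ?invr_gt0 ?exprn_gt0 // invrK.
apply: le_trans (ler_wpM2l (ler0n _ _) (expn_le_fact s)) _.
rewrite mulrCA exprMn ler_wpM2l ?exprn_ge0 // -natrM bin_ffact -natrX ler_nat.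
rewrite ffact_prod; apply: leq_trans (_ : \prod_(i < s) n <= _)%N.
  by apply: leq_prod => i _; apply: leq_subr.
by rewrite prod_nat_const card_ord.
Qed.

Lemma sum_half_le2 (m : nat) : \sum_(i < m) 2^-1 ^+ i <= 2 :> R.
Proof.
suff -> : \sum_(i < m) 2^-1 ^+ i = 2 - 2 * 2^-1 ^+ m :> R.
  by rewrite gerBl mulr_ge0 // exprn_ge0.
elim: m => [|m IH]; first by rewrite big_ord0 expr0; ring.
by rewrite big_ord_recr /= IH exprS; field.
Qed.

(** Put [r = s / n]. The binomials contribute [r] to the powers -1 and -3 and the six choices to the
    power 6, so the term is at most [(256 / 27 * 12 ^+ 6 * r ^+ 2) ^+ s]. The constant 40 makes the
    base at most [r / 4]. *)
Lemma confined_term_le (n s : nat) : (0 < s)%N -> 40 * 12 ^+ 6 * s%:R <= n%:R :> R ->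
  'C(n, s)%:R * ('C(n, 3 * s)%:R * (12 * s%:R / n%:R) ^+ (6 * s)) <= n%:R^-1 * 2^-1 ^+ s :> R.
Proof.
move=> s0 sn; have ss : 0 < s%:R :> R by rewrite ltr0n.
have nn : 0 < n%:R :> R by apply: lt_le_trans sn; rewrite !mulr_gt0 // exprn_gt0.
set r : R := s%:R / n%:R.
have r0 : 0 < r by rewrite divr_gt0.
have rB : 40 * 12 ^+ 6 * r <= 1.
  by rewrite mulrA ler_pdivrMr // mul1r.
have h1 := bin_le_expn n s0.
have h2 : 'C(n, 3 * s)%:R <= ((4 * n%:R / (3 * s%:R)) ^+ 3) ^+ s :> R.
  have := bin_le_expn n (s := 3 * s); rewrite muln_gt0 s0 natrM exprM; exact.
apply: (@le_trans _ _ ((4 * n%:R / s%:R) ^+ s * (((4 * n%:R / (3 * s%:R)) ^+ 3) ^+ s * (12 * s%:R / n%:R) ^+ 6 ^+ s))).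
  have t0 : 0 <= (12 * s%:R / n%:R) ^+ 6 ^+ s :> R.
    by rewrite exprn_ge0 // exprn_ge0 // divr_ge0 // mulr_ge0.
  rewrite [in leLHS]exprM; apply: ler_pM; [exact: ler0n|by rewrite mulr_ge0|exact: h1|].
  by rewrite ler_wpM2r.
rewrite -!exprMn.
have -> : 4 * n%:R / s%:R * ((4 * n%:R / (3 * s%:R)) ^+ 3 * (12 * s%:R / n%:R) ^+ 6) = 256 / 27 * 12 ^+ 6 * r ^+ 2.
  by rewrite /r; field; rewrite !gt_eqF.
apply: (@le_trans _ _ ((r / 4) ^+ s)).
  rewrite lerXn2r ?nnegrE ?mulr_ge0 ?exprn_ge0 ?invr_ge0 ?(ltW r0) //.
  have -> : 256 / 27 * 12 ^+ 6 * r ^+ 2 = (64 / 675) * (40 * 12 ^+ 6 * r) * r * (5 / 2) by field.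
  move: rB; set y := 40 * 12 ^+ 6 * r => rB; have := ler_wpM2r (ltW r0) rB; clearbody y; lra.
rewrite exprMn.
have r1 : r ^+ s <= r.
  case: (s) s0 => // s' _; rewrite exprS ger_pMr // exprn_ile1 ?(ltW r0) //.
  apply: le_trans rB; rewrite ler_peMl ?(ltW r0) //.
  by rewrite mulr_ege1 ?exprn_ege1 // ler1n.
apply: (@le_trans _ _ (r * 4^-1 ^+ s)); first by rewrite ler_wpM2r // exprn_ge0.
rewrite /r [s%:R / _]mulrC -mulrA ler_wpM2l ?invr_ge0 ?(ltW nn) //.
have -> : 4^-1 = 2^-1 * 2^-1 :> R by field.
rewrite exprMn mulrA ler_piMl ?exprn_ge0 // exprVn ler_pdivrMr ?exprn_gt0 // mul1r -natrX ler_nat.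
by apply: ltnW; apply: ltn_expl.
Qed.

Variables (n : nat) (p : R).
Hypothesis p01 : 0 <= p <= 1.
Local Notation graph := {set {set 'I_n}}.
Local Notation N := (n%:R : R).

(** There are [#|W| ^ (6 * #|S|)] candidate choices, and each one that can be confined at all needs
    [6 * #|S|] distinct edges. *)
Lemma mean_card_confined (e0 : 'I_n) (S W : {set 'I_n}) :
  gnp_mean p (fun G : graph => #|confined G e0 S W|%:R) <= (#|W|%:R * p) ^+ (6 * #|S|).
Proof.
have p0 : 0 <= p by case/andP: p01.
pose D := setX S [set: 'I_6].
have cD : #|D| = (6 * #|S|)%N by rewrite cardsX cardsT card_ord mulnC.
pose fam : pred {ffun 'I_n * 'I_6 -> 'I_n} := pffun_on e0 (mem D) (mem W).
apply: (@le_trans _ _ (\sum_(h : {ffun 'I_n * 'I_6 -> 'I_n} | fam h) p ^+ (6 * #|S|))); last first.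
  rewrite sumr_const (card_pffun_on e0 (mem D) (mem W)) cD exprMn -[leLHS]mulr_natl.
  by rewrite natrX.
have -> : gnp_mean p (fun G : graph => #|confined G e0 S W|%:R) =
    \sum_(h : {ffun 'I_n * 'I_6 -> 'I_n}) gnp_mean p (fun G : graph => (h \in confined G e0 S W)%:R).
  rewrite -gnp_mean_sum; apply: eq_bigr => G _; congr (_ * _).
  by rewrite -sum1_card natr_sum big_mkcond; apply: eq_bigr => h _; case: (_ \in _).
rewrite [leRHS]big_mkcond; apply: ler_sum => h _.
(* Distinctness of the edges of [h] does not depend on the graph, so any one [G0] witnesses it. *)
have [[G0 hG0]|no] := pselect (exists G0 : graph, h \in confined G0 e0 S W); last first.
  rewrite /gnp_mean big1 => [|G _]; first by case: ifP => // _; rewrite exprn_ge0.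
  by case: (boolP (h \in _)) => [hG|]; rewrite ?mulr0 //; case: no; exists G.
move: hG0; rewrite inE => /andP[/forallP h1 /forallP h2].
have -> : fam h.
  apply/pffun_onP; split.
    apply/subsetP => i; rewrite inE => hi; rewrite inE in_setT andbT.
    by have := h1 i; case: ifP => // _ /eqP e; rewrite e eqxx in hi.
  move=> _ /imageP[i iD ->]; move: iD; rewrite inE in_setT andbT => iS.
  by have := h1 i; rewrite iS => /andP[].
pose T := [set [set i.1; h i] | i in D].
have cT : #|T| = (6 * #|S|)%N.
  rewrite -cD card_in_imset // => i j; rewrite !inE !andbT => iS jS e; apply/eqP.
  by have := h2 i => /forallP/(_ j); rewrite iS jS e eqxx.
rewrite -cT; apply: le_trans (gnp_prob_subset p01 T); rewrite gnp_probE.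
apply: ler_gnp_mean => // G _; rewrite ler_nat.
case: (boolP (h \in _)) => // hG; rewrite asboolT //.
apply/subsetP => _ /imsetP[i + ->]; rewrite inE in_setT andbT => iS.
move: hG; rewrite inE => /andP[/forallP/(_ i)]; by rewrite iS => /andP[].
Qed.

(** For [#|S| = s] the powers of [p] cancel, since [4 / (p * N) * (3 * s * p) = 12 * s / N]; the
    terms then decay geometrically in [s]. *)
Lemma mean_few_confined (e0 : 'I_n) (k : nat) : 0 < p -> 40 * 12 ^+ 6 * k%:R <= N ->
  gnp_mean p (fun G : graph => few_confined G p e0 k) <= 2 * N^-1.
Proof.
move=> p0 kn.
have n0 : (0 < n)%N := leq_ltn_trans (leq0n e0) (ltn_ord e0).
have nn : 0 < N by rewrite ltr0n.
pose g s : R := 'C(n, 3 * s)%:R * (12 * s%:R / N) ^+ (6 * s).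
apply: (@le_trans _ _ (\sum_(S : {set 'I_n} | (S != set0) && (#|S| <= k)%N) g #|S|)).
  rewrite /few_confined gnp_mean_sum; apply: ler_sum => S _.
  rewrite gnp_mean_sum /g -[X in 'C(X, _)]card_ord -card_draws [leRHS]mulr_natl -[leRHS]sumr_const.
  rewrite [leRHS](eq_bigl (fun W : {set 'I_n} => #|W| == 3 * #|S|)%N); last by move=> W; rewrite inE.
  apply: ler_sum => W /eqP cW; rewrite gnp_meanZ.
  apply: le_trans (ler_wpM2l _ (mean_card_confined e0 S W)) _.
    by rewrite exprn_ge0 // divr_ge0 // mulr_ge0 // ltW.
  rewrite -exprMn cW natrM (_ : 4 / (p * N) * (3 * #|S|%:R * p) = 12 * #|S|%:R / N) //.
  by field; rewrite !gt_eqF.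
rewrite (partition_big (fun S : {set 'I_n} => inord #|S| : 'I_k.+1) (fun s : 'I_k.+1 => (0 < s)%N)) /=; last first.
  by move=> S /andP[S0 Sk]; rewrite inordK // card_gt0.
apply: (@le_trans _ _ (\sum_(s < k.+1) N^-1 * 2^-1 ^+ s)); last first.
  by rewrite -mulr_sumr mulrC ler_wpM2r ?invr_ge0 ?(ltW nn) // sum_half_le2.
rewrite [leRHS](bigID (fun s : 'I_k.+1 => (0 < s)%N)) /=.
apply: (@le_trans _ _ (\sum_(s < k.+1 | (0 < s)%N) N^-1 * 2^-1 ^+ s)); last first.
  by rewrite lerDl sumr_ge0 // => s _; rewrite mulr_ge0 ?invr_ge0 ?exprn_ge0 ?(ltW nn).
apply: ler_sum => s s0.
apply: le_trans (confined_term_le s0 _); last first.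
  apply: le_trans kn; rewrite ler_wpM2l ?mulr_ge0 ?exprn_ge0 // ler_nat.
  by rewrite -ltnS ltn_ord.
rewrite -[X in 'C(X, s)]card_ord -card_draws mulr_natl -[leRHS]sumr_const.
rewrite big_mkcond [leRHS]big_mkcond /=; apply: ler_sum => S _; rewrite inE.
have gs0 : 0 <= g s by rewrite mulr_ge0 // exprn_ge0 // divr_ge0 // mulr_ge0.
case: ifP => [/andP[/andP[_ Sk] /eqP es]|_]; last by case: ifP.
have -> : #|S| = s :> nat by rewrite -es inordK.
by rewrite eqxx.
Qed.

End ConfinedMean.

(** * All properties hold with probability close to one *)

Section GoodGraphs.
Variables (R : realType) (n : nat) (p gam dl : R) (D1 k : nat) (e0 : 'I_n).
Local Notation graph := {set {set 'I_n}}.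
Local Notation N := (n%:R : R).
Hypothesis p0 : 0 < p.
Hypothesis p1 : p <= 1.
Hypothesis gam01 : 0 < gam <= 1.
Hypothesis dl01 : 0 <= dl <= 1.
Hypothesis tail_small :
  8 * (16 / (gam ^+ 2 / 32)) ^+ (12 + D1) * expR (- (gam ^+ 2 / 32 / 4 * p * N)) <= 1.
Hypothesis degree_small : N * expR (- (dl ^+ 2 / 8 * p * N)) <= N^-1.
Hypothesis k_small : 40 * 12 ^+ 6 * k%:R <= N.

Let p01 : 0 <= p <= 1. Proof. by rewrite (ltW p0) p1. Qed.
Let n0 : (0 < n)%N. Proof. exact: leq_ltn_trans (leq0n e0) (ltn_ord e0). Qed.
Let N0 : 0 < N. Proof. by rewrite ltr0n. Qed.
Let g0 : 0 < gam. Proof. by case/andP: gam01. Qed.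
Let b : R := gam ^+ 2 / 32.
Let L0 : R := 16 / b.
(** The tail bound is the fourth power of [W ^+ n]. Each union bound over sparse graphs costs one
    factor [W ^+ n], and another one absorbs the powers of [L0]. *)
Let W : R := expR (- (b / 4 * p * N)).

Let b0 : 0 < b. Proof. by rewrite divr_gt0 ?exprn_gt0. Qed.
Let b1 : b <= 1.
Proof.
rewrite ler_pdivrMr // mul1r; apply: (@le_trans _ _ 1); last by rewrite ler1n.
by rewrite exprn_ile1 ?(ltW g0) //; case/andP: gam01.
Qed.

Let L0_ge1 : 1 <= L0.
Proof.
rewrite /L0 ler_pdivlMr // mul1r; apply: le_trans b1 _; by rewrite ler1n.
Qed.

Let L0_ge0 : 0 <= L0. Proof. exact: le_trans ler01 L0_ge1. Qed.
Let W0 : 0 < W. Proof. exact: expR_gt0. Qed.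
Let W1 : W <= 1.
Proof.
have h1 : 0 <= b / 4 by rewrite divr_ge0 // ltW.
by rewrite /W -[leRHS]expR0 ler_expR oppr_le0 mulr_ge0 ?(mulr_ge0 h1) ?(ltW p0).
Qed.

Let tailE : tail n p gam = (W ^+ n) ^+ 4.
Proof. by rewrite /tail /W -!expRM_natl -/b; congr expR; by field. Qed.

(** This is [sum_expr_card_le] with [th = b / 16], whose inverse is [L0]. *)
Let sum_small_graphs K :
  \sum_(R0 : graph | (R0 \subset pairs n) && (#|R0| <= K * n)%N) (4 * p) ^+ #|R0|
    <= (L0 ^+ K) ^+ n * (W ^+ n)^-1.
Proof.
have th : 0 < b / 16 <= 1.
  apply/andP; split; first by rewrite divr_gt0.
  by rewrite ler_pdivrMr // mul1r; apply: le_trans b1 _; rewrite ler1n.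
have p4 : 0 <= 4 * p by rewrite mulr_ge0 // ltW.
apply: le_trans (sum_expr_card_le n (K * n) p4 th) _.
rewrite invf_div -/L0 exprM -/b; apply: ler_wpM2l; first exact: exprn_ge0 (exprn_ge0 _ L0_ge0).
rewrite /W -expRM_natl -expRN ler_expR mulrN opprK.
have -> : n%:R * (b / 4 * p * N) = 4 * p * (b / 16) * (n ^ 2)%:R.
  by rewrite natrX; field.
apply: ler_wpM2l; first by rewrite mulr_ge0 //; case/andP: th => /ltW.
rewrite (ler_nat R); exact: card_pairs_le.
Qed.

Let lw : (L0 ^+ (12 + D1)) ^+ n * W ^+ n <= 8^-1 ^+ n.
Proof.
have LW0 : 0 <= L0 ^+ (12 + D1) * W by exact: mulr_ge0 (exprn_ge0 _ L0_ge0) (ltW W0).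
have h8 : 0 <= 8^-1 :> R by rewrite invr_ge0.
rewrite -exprMn; apply: lerXn2r; rewrite ?nnegrE //.
have := tail_small; rewrite -/b -/L0 -/W -mulrA => h.
by rewrite -[leRHS]mulr1 ler_pdivlMl.
Qed.

Let N_le : N <= 2 ^+ n. Proof. by rewrite -natrX ler_nat ltnW // ltn_expl. Qed.

Let half_le : 2^-1 ^+ n <= N^-1.
Proof. by rewrite exprVn lef_pV2 ?posrE ?exprn_gt0. Qed.

Let w0 : 0 < W ^+ n. Proof. exact: exprn_gt0. Qed.
Let w1 : W ^+ n <= 1. Proof. by rewrite exprn_ile1 // ltW. Qed.
Let l0 : 0 <= (L0 ^+ (12 + D1)) ^+ n.
Proof. exact: exprn_ge0 (exprn_ge0 _ L0_ge0). Qed.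

Let fans_le : gnp_prob p (fun G : graph => ~ sparse_fans G p gam) <= N^-1.
Proof.
apply: le_trans (prob_not_sparse_fans n p01 gam01) _.
apply: le_trans (ler_wpM2r _ (sum_small_graphs 12)) _.
  by rewrite !mulr_ge0 ?exprn_ge0 ?expR_ge0.
rewrite tailE.
have -> : (L0 ^+ 12) ^+ n * (W ^+ n)^-1 * (N * 2 ^+ n * (W ^+ n) ^+ 4) =
   N * 2 ^+ n * ((L0 ^+ 12) ^+ n * W ^+ n) * (W ^+ n) ^+ 2.
  by move: w0; set w := W ^+ n; set l := _ ^+ n => h; field; rewrite gt_eqF.
have h : (L0 ^+ 12) ^+ n * W ^+ n <= 8^-1 ^+ n.
  apply: le_trans lw; rewrite ler_wpM2r ?(ltW w0) // lerXn2r ?nnegrE ?exprn_ge0 ?L0_ge0 //.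
  by rewrite ler_weXn2l // leq_addr.
(* The choices of [y] and [A] cost at most [4 ^+ n], which the factor [8^-1 ^+ n] from [lw]
   outweighs. *)
apply: (@le_trans _ _ (2 ^+ n * 2 ^+ n * 8^-1 ^+ n * 1)); last first.
  by rewrite mulr1 -!exprMn; apply: le_trans half_le; rewrite le_eqVlt (_ : 2 * 2 * 8^-1 = 2^-1) ?eqxx //; field.
have X0 : 0 <= (L0 ^+ 12) ^+ n * W ^+ n.
  by apply: mulr_ge0; [exact: exprn_ge0 (exprn_ge0 _ L0_ge0)|exact: ltW].
have t0 : 0 <= N * 2 ^+ n by rewrite mulr_ge0 // exprn_ge0.
apply: ler_pM; [exact: mulr_ge0|by rewrite exprn_ge0 // ltW| |by rewrite exprn_ile1 // ltW].
by apply: ler_pM => //; rewrite ler_wpM2r // exprn_ge0.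
Qed.

Let misses_le : gnp_prob p (fun G : graph => ~ sparse_misses G p gam D1) <= N^-1.
Proof.
apply: le_trans (prob_not_sparse_misses n p01 D1 gam01) _.
rewrite tailE.
apply: (@le_trans _ _ (((L0 ^+ 12) ^+ n * (W ^+ n)^-1) * ((L0 ^+ D1) ^+ n * (W ^+ n)^-1) * (W ^+ n) ^+ 4)).
  apply: ler_wpM2r; first by apply: exprn_ge0; exact: ltW.
  by apply: ler_pM; rewrite ?sum_small_graphs // sumr_ge0 // => i _; rewrite exprn_ge0 // mulr_ge0 // ltW.
have -> : ((L0 ^+ 12) ^+ n * (W ^+ n)^-1) * ((L0 ^+ D1) ^+ n * (W ^+ n)^-1) * (W ^+ n) ^+ 4 =
   ((L0 ^+ (12 + D1)) ^+ n * W ^+ n) * W ^+ n.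
  have -> : (L0 ^+ (12 + D1)) ^+ n = (L0 ^+ 12) ^+ n * (L0 ^+ D1) ^+ n.
    by rewrite -(exprMn n (L0 ^+ 12)) -exprD.
  move: w0; move: (W ^+ n) ((L0 ^+ 12) ^+ n) ((L0 ^+ D1) ^+ n) => w l l' h.
  by field; rewrite gt_eqF.
apply: le_trans half_le; rewrite -[leRHS]mulr1; apply: ler_pM => //.
- by rewrite mulr_ge0 // ltW.
- exact: ltW.
apply: le_trans lw _; rewrite lerXn2r ?nnegrE ?invr_ge0 //; lra.
Qed.

Let sets_le : gnp_prob p (fun G : graph => ~ sparse_sets G p gam) <= N^-1.
Proof.
apply: le_trans (prob_not_sparse_sets n p01 gam01) _; rewrite tailE.
apply: (@le_trans _ _ (2 ^+ n * 8^-1 ^+ n)); last first.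
  rewrite -exprMn; apply: le_trans half_le; rewrite lerXn2r ?nnegrE ?mulr_ge0 ?invr_ge0 //; lra.
rewrite ler_wpM2l ?exprn_ge0 //; apply: le_trans lw.
apply: (@le_trans _ _ (1 * W ^+ n)); last first.
  by rewrite ler_wpM2r ?(ltW w0) // !exprn_ege1.
rewrite mul1r exprS ger_pMr //; apply: exprn_ile1 => //; exact: ltW.
Qed.

Let degrees_le : gnp_prob p (fun G : graph =>
  exists2 v : 'I_n, true & outdeg R G v < p * (N - 1) - dl * p * N) <= N^-1.
Proof.
apply: le_trans (gnp_prob_exists p01 _ _) _.
apply: le_trans degree_small.
apply: (@le_trans _ _ (\sum_(v < n) expR (- (dl ^+ 2 / 8 * p * N)))).
  by apply: ler_sum => v _; apply: prob_low_degree.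
by rewrite sumr_const card_ord mulr_natl.
Qed.

Let confined_le : gnp_prob p (fun G : graph => 1 <= few_confined G p e0 k) <= 2 * N^-1.
Proof.
apply: le_trans _ (mean_few_confined p01 e0 p0 k_small).
apply: gnp_markov => // G.
apply: sumr_ge0 => S _; apply: sumr_ge0 => U _.
by rewrite mulr_ge0 // exprn_ge0 // divr_ge0 // mulr_ge0 // ltW.
Qed.

(** The confined choices fail with probability at most [2 * N^-1], each of the other four properties
    with at most [N^-1]. *)
Lemma gnp_prob_good : 1 - 6 * N^-1 <= gnp_prob p (fun G : graph =>
  [/\ sparse_fans G p gam, sparse_misses G p gam D1, sparse_sets G p gam,
      few_confined G p e0 k < 1 & forall v, p * (N - 1) - dl * p * N <= outdeg R G v]).
Proof.
rewrite gnp_prob_not // lerD2l lerN2.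
pose B1 (G : graph) := ~ sparse_fans G p gam.
pose B2 (G : graph) := ~ sparse_misses G p gam D1.
pose B3 (G : graph) := ~ sparse_sets G p gam.
pose B4 (G : graph) := 1 <= few_confined G p e0 k.
pose B5 (G : graph) := exists2 v : 'I_n, true & outdeg R G v < p * (N - 1) - dl * p * N.
apply: le_trans (ler_gnp_prob p01 (B := fun G => B1 G \/ (B2 G \/ (B3 G \/ (B4 G \/ B5 G)))) _) _.
  move=> G _ bad; apply: contrapT => no; apply: bad.
  have [n1 no1] : ~ B1 G /\ ~ (B2 G \/ (B3 G \/ (B4 G \/ B5 G))) by tauto.
  have [n2 no2] : ~ B2 G /\ ~ (B3 G \/ (B4 G \/ B5 G)) by tauto.
  have [n3 [n4 n5]] : ~ B3 G /\ (~ B4 G /\ ~ B5 G) by tauto.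
  split; [exact: contrapT|exact: contrapT|exact: contrapT|by rewrite ltNge; apply/negP|].
  by move=> v; rewrite leNgt; apply/negP => lt; apply: n5; exists v.
apply: le_trans (gnp_prob_or p01 _ _) _.
apply: le_trans (lerD fans_le (gnp_prob_or p01 _ _)) _.
apply: le_trans (lerD (lexx _) (lerD misses_le (gnp_prob_or p01 _ _))) _.
apply: le_trans (lerD (lexx _) (lerD (lexx _) (lerD sets_le (gnp_prob_or p01 _ _)))) _.
apply: le_trans (lerD (lexx _) (lerD (lexx _) (lerD (lexx _) (lerD confined_le degrees_le)))) _.
by rewrite le_eqVlt; apply/orP; left; apply/eqP; ring.
Qed.

End GoodGraphs.

(** * Both Dirac conditions, and the choice of the constants *)

Lemma mindeg_le n (H : {set {set 'I_n}}) v : (mindeg H <= deg H v)%N.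
Proof.
rewrite /mindeg; have : v \in index_enum 'I_n by exact: mem_index_enum.
elim: (index_enum _) => // x s IH; rewrite inE big_cons => /orP[/eqP <-|/IH vs].
  exact: geq_minl.
by apply: leq_trans vs; apply: geq_minr.
Qed.

(** Both Dirac conditions give minimum degree at least [(2^-1 + eps / 2) * p * n]. In the relative
    case the degrees of [G] are at least [(1 - eps / 2) * p * n], and [(2^-1 + eps) * (1 - eps / 2)]
    is at least [2^-1 + eps / 2] because [eps <= 2^-1]. *)
Lemma gnp_prob_rainbow_hamiltonian (R : realType) (n D1 k : nat) (p eps mu gam sig : R) :
  (3 <= n)%N -> 0 < p <= 1 -> 0 < eps < 2^-1 -> 0 < gam <= 1 -> 0 < mu -> 96 * mu <= 1 -> 0 < sig ->
  4 <= D1%:R * gam ^+ 2 ->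
  4 * gam + (48 + 2 * D1%:R) * mu < 2 * (eps / 2) * sig ^+ 2 ->
  gam + 24 * mu < eps / 2 * sig ->
  sig * n%:R <= k.+1%:R -> 40 * 12 ^+ 6 * k%:R <= n%:R :> R ->
  8 * (16 / (gam ^+ 2 / 32)) ^+ (12 + D1) * expR (- (gam ^+ 2 / 32 / 4 * p * n%:R)) <= 1 ->
  n%:R * expR (- ((eps / 4) ^+ 2 / 8 * p * n%:R)) <= n%:R^-1 -> 4 <= eps * n%:R ->
  1 - 6 * n%:R^-1 <= gnp_prob p (fun G : {set {set 'I_n}} =>
          (forall H : {set {set 'I_n}}, relative_Dirac eps G H ->
             rainbow_hamiltonian (mu * p * n%:R) H) /\
          (forall H : {set {set 'I_n}}, absolute_Dirac eps p G H ->
             rainbow_hamiltonian (mu * p * n%:R) H)).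
Proof.
move=> n3 /andP[p0 p1] /andP[eps0 eps1] g01 mu0 mu1 sig0 D1g sm1 sm2 ksig kn tl dg nbig.
have n0 : (0 < n)%N by apply: leq_trans n3.
pose e0 : 'I_n := Ordinal n0.
have dl01 : 0 <= eps / 4 <= 1 by apply/andP; split; lra.
have p01 : 0 <= p <= 1 by rewrite ltW.
have := gnp_prob_good e0 p0 p1 g01 dl01 tl dg kn; move/le_trans; apply.
apply: ler_gnp_prob => // G GP [fG mG sG cG dG].
have N0 : 0 < n%:R :> R by rewrite ltr0n.
have pN0 : 0 < p * n%:R by rewrite mulr_gt0.
have k3 : (3 * k <= n)%N.
  rewrite -(ler_nat R) natrM; apply: le_trans kn; rewrite ler_wpM2r //.
  apply: (@le_trans _ _ (40 * 1)); first by rewrite mulr1 ler_nat.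
  by rewrite ler_wpM2l // exprn_ege1 // ler1n.
have main (H : {set {set 'I_n}}) : H \subset G ->
    (forall v, (2^-1 + eps / 2) * p * n%:R <= outdeg R H v) -> rainbow_hamiltonian (mu * p * n%:R) H.
  move=> HG dH K c cb; have /andP[g0 g1] := g01.
  have e20 : 0 < eps / 2 by rewrite divr_gt0.
  exact: (rainbow_hamilton_cycle n3 GP HG p0 g0 mu0 e20 sig0 g1 mu1 D1g sm1 sm2 ksig k3 dH cb fG mG sG cG).
split=> H [HG dH]; apply: (main H HG) => v; have HP := subset_trans HG GP.
  rewrite -(deg_outdeg R) //; apply: le_trans (dH v); rewrite (deg_outdeg R) //.
  have e1 : 0 <= 2^-1 + eps by rewrite addr_ge0 ?invr_ge0 // ltW.
  apply: le_trans (ler_wpM2l e1 (dG v)).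
  have low : (1 - eps / 2) * (p * n%:R) <= p * (n%:R - 1) - eps / 4 * p * n%:R.
    have : p * 4 <= p * (eps * n%:R) by rewrite ler_wpM2l // ltW.
    lra.
  apply: le_trans (ler_wpM2l e1 low).
  rewrite mulrA -mulrA ler_wpM2r ?(ltW pN0) //.
  have : 0 <= eps * (2^-1 - eps) by rewrite mulr_ge0 ?subr_ge0 ?(ltW eps0) ?(ltW eps1).
  nra.
rewrite -(deg_outdeg R) //; apply: le_trans (_ : (mindeg H)%:R <= _); last by rewrite ler_nat mindeg_le.
apply: le_trans dH; rewrite -!mulrA ler_wpM2r ?(ltW pN0) //; lra.
Qed.

Lemma exp_tail_small (R : realType) (a b x : R) : 0 < a -> 0 < b -> b / a <= x ->
  b * expR (- (a * x)) <= 1.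
Proof.
move=> a0 b0 bx; have bax : b <= a * x by rewrite mulrC -ler_pdivrMr.
rewrite expRN ler_pdivrMr ?expR_gt0 // mul1r; apply: le_trans bax _.
by apply: le_trans (expR_ge1Dx _); rewrite lerDr.
Qed.

Local Open Scope classical_set_scope.
Local Open Scope ring_scope.

Theorem corollary1p6 (R : realType) (eps : R) (heps : 0 < eps < 2^-1) :
  exists C mu : R, [/\ 0 < C, 0 < mu &
    forall p : nat -> R,
      (\forall n \near \oo, C * ln n%:R / n%:R <= p n <= 1) ->
      gnp_prob (p n) (fun G : {set {set 'I_n}} =>
          (forall H : {set {set 'I_n}}, relative_Dirac eps G H ->
             rainbow_hamiltonian (mu * p n * n%:R) H) /\
          (forall H : {set {set 'I_n}}, absolute_Dirac eps (p n) G H ->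
             rainbow_hamiltonian (mu * p n * n%:R) H))
        @[n --> \oo] --> (1 : R)].
Proof.
have /andP[eps0 eps1] := heps.
pose B : R := 40 * 12 ^+ 6.
have B1 : 1 <= B by rewrite mulr_ege1 ?exprn_ege1 // ler1n.
have B0 : 0 < B := lt_le_trans ltr01 B1.
pose sig : R := B^-1.
have sig0 : 0 < sig by rewrite invr_gt0.
have sig1 : sig <= 1 by rewrite invf_le1.
pose s : R := eps / 2 * sig ^+ 2.
have s0 : 0 < s by rewrite mulr_gt0 ?divr_gt0 ?exprn_gt0.
have ss : s <= eps / 2 * sig by rewrite ler_wpM2l ?divr_ge0 ?(ltW eps0) // expr2 ger_pMr.
have s1 : s <= 4^-1.
  apply: le_trans ss _; apply: (@le_trans _ _ (eps / 2)); last by lra.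
  by rewrite ger_pMr // divr_gt0.
(* Both smallness conditions are measured by [s]: with [d * mu = s / 2] below, [4 * gam + d * mu] is
   less than [2 * s], and [gam + 24 * mu <= s / 2] is less than [eps / 2 * sig]. *)
pose gam : R := s / 4.
have g0 : 0 < gam by rewrite divr_gt0.
have g01 : 0 < gam <= 1 by rewrite g0 /gam; lra.
pose D1 := (Num.truncn (4 / gam ^+ 2)).+1.
have D1g : 4 <= D1%:R * gam ^+ 2.
  by rewrite -ler_pdivrMr ?exprn_gt0 // ltW // real_truncnS_gt // num_real.
pose d : R := 48 + 2 * D1%:R.
have d48 : 48 <= d by rewrite lerDl mulr_ge0.
have d0 : 0 < d by apply: lt_le_trans d48.
pose mu : R := s / (2 * d).
have mud : d * mu = s / 2 by rewrite /mu; field; rewrite gt_eqF.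
have mu0 : 0 < mu by rewrite divr_gt0 // mulr_gt0.
have mu48 : 48 * mu <= s / 2 by rewrite -mud ler_wpM2r // ltW.
(* Chosen so that [(eps / 4) ^+ 2 / 8 * C = 2]: a given degree is too low with probability at most
   [n ^ -2], which survives the union bound over the vertices. *)
pose C : R := 16 / (eps / 4) ^+ 2.
have C0 : 0 < C by rewrite divr_gt0 // exprn_gt0 // divr_gt0.
exists C, mu; split => // p hp.
have b0 : 0 < gam ^+ 2 / 32 by rewrite divr_gt0 // exprn_gt0.
pose L : R := 8 * (16 / (gam ^+ 2 / 32)) ^+ (12 + D1).
have L0 : 0 < L by rewrite mulr_gt0 // exprn_gt0 // divr_gt0.
have a0 : 0 < gam ^+ 2 / 32 / 4 by rewrite divr_gt0.
(* Once [p n * n] is at least [M], the exponential tail beats the constant [L]; this holds as soon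
   as [ln n] reaches [M / C]. *)
pose M := L / (gam ^+ 2 / 32 / 4).
have M0 : 0 < M by rewrite divr_gt0.
(* As [harmonic n] is [1 / (n + 1)], the error [6 / n] is at most [12 * harmonic n]. *)
apply: (@squeeze_cvgr nat \oo _ R (fun n => 1 - 12 * harmonic n) (fun=> 1)); last 2 first.
- rewrite -[X in _ --> X]subr0 -[X in _ --> _ - X](mulr0 12).
  by apply: cvgB; [exact: cvg_cst|apply: cvgMr; exact: cvg_harmonic].
- exact: cvg_cst.
near=> n.
have /andP[pl p1] : C * ln n%:R / n%:R <= p n <= 1 by near: n.
have n3 : (3 <= n)%N by near: n; exact: nbhs_infty_ge.
have ne : 4 / eps <= n%:R :> R by near: n; exact: nbhs_infty_ger.
have nM : expR (M / C) <= n%:R by near: n; exact: nbhs_infty_ger.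
have n0 : (0 < n)%N by apply: leq_trans n3.
have N0 : 0 < n%:R :> R by rewrite ltr0n.
have pl' : C * ln n%:R <= p n * n%:R by rewrite -ler_pdivrMr.
have lnM : M <= C * ln n%:R.
  rewrite mulrC -ler_pdivrMr // -[leLHS]expRK; by rewrite ler_ln ?posrE ?expR_gt0.
have pN : M <= p n * n%:R by apply: le_trans pl'.
have p0 : 0 < p n by rewrite -(pmulr_lgt0 _ N0); apply: lt_le_trans pN.
have p01 : 0 <= p n <= 1 by rewrite p1 ltW.
rewrite gnp_prob_le1 // andbT.
pose k := Num.truncn (sig * n%:R).
have sN : 0 <= sig * n%:R by rewrite mulr_ge0 ?ltW.
have /andP[k1 k2] := truncn_itv sN.
apply: le_trans (gnp_prob_rainbow_hamiltonian (D1 := D1) (k := k) (sig := sig) (gam := gam) n3 _ heps g01 mu0 _ sig0 D1g _ _ _ _ _ _ _).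
- rewrite lerD2l lerN2 /harmonic /= ler_pdivrMr // mulrAC ler_pdivlMr ?ltr0n //.
  by rewrite -natr1; have : 1 <= n%:R :> R by [rewrite ler1n]; lra.
- by rewrite p0.
- lra.
- rewrite -/d mud (_ : 2 * (eps / 2) * sig ^+ 2 = 2 * s); last by rewrite /s; ring.
  by rewrite /gam; lra.
- by apply: lt_le_trans ss; rewrite /gam; lra.
- exact: ltW.
- rewrite -/B.
  by have := ler_wpM2l (ltW B0) k1; rewrite mulrA mulfV ?gt_eqF // mul1r.
- by rewrite -/L -[X in - X]mulrA; apply: exp_tail_small.
- have lnN : expR (ln n%:R) = n%:R :> R by rewrite lnK // posrE.
  have x2 : ln n%:R + ln n%:R <= (eps / 4) ^+ 2 / 8 * p n * n%:R.
    have e2 : 0 < (eps / 4) ^+ 2 / 8 by rewrite !divr_gt0 // exprn_gt0 // divr_gt0.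
    rewrite -mulrA; apply: le_trans (ler_wpM2l (ltW e2) pl').
    by rewrite le_eqVlt; apply/orP; left; apply/eqP; rewrite /C; field; rewrite gt_eqF.
  apply: (@le_trans _ _ (n%:R * expR (- (ln n%:R + ln n%:R)))).
    by rewrite ler_wpM2l // ler_expR lerN2.
  by rewrite expRN expRD lnN invfM mulrA mulfV ?mul1r // gt_eqF.
- by rewrite mulrC -ler_pdivrMr.
Unshelve. all: by end_near.
Qed.
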